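(* Let $G$ be a countable group. Then $G$ is infinite locally finite if and only if $$\operatorname{hdim}^G(\underline{E}G)=\operatorname{hdim}^G(\underline{\underline{E}}G)=1.$$
   Context: Groups are discrete. A group is locally finite if each of its finitely generated subgroups is finite. For a family $\mathcal{F}$ of subgroups of $G$ (closed under conjugation and taking subgroups), a model for $E_{\mathcal{F}}(G)$ is a $G$-CW-complex $X$ with $X^H$ contractible for $H\in\mathcal{F}$ and empty for $H\notin\mathcal{F}$; it is unique up to $G$-homotopy equivalence. $\underline{E}G$ and $\underline{\underline{E}}G$ denote $E_{\mathcal{F}}(G)$ for $\mathcal{F}$ the family of finite subgroups and of virtually cyclic subgroups (including finite ones), respectively. $\operatorname{hdim}^G(X)\in\{0,1,\dots\}\sqcup\{\infty\}$ is the infimum of the dimensions of all $G$-CW-complexes $G$-homotopy equivalent to $X$. *)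

(* Defs.v *)
From HB Require Import structures.
From mathcomp Require Import all_boot all_order all_algebra.
From mathcomp Require Import all_classical all_reals all_analysis.

Set Implicit Arguments.
Unset Strict Implicit.
Unset Printing Implicit Defensive.

Import Order.TTheory GRing.Theory Num.Theory.
Import numFieldNormedType.Exports.

Local Open Scope classical_set_scope.
Local Open Scope ring_scope.

Section Groups.
Context {G : groupType}.
Implicit Types H S : set G.

Definition is_subgroup H : Prop := group_closed [in H].

Definition gen S : set G := smallest is_subgroup S.

Definition lcoset_of H (x : G) : set G := [set (x * h)%g | h in H].

Definition locally_finite : Prop :=
  forall S, finite_set S -> finite_set (gen S).

Definition fin_subgroups : set (set G) :=
  [set H | is_subgroup H /\ finite_set H].

(* Some cyclic subgroup of H has finite index in H; finite groups are thus
   included. *)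
Definition vcyc_subgroups : set (set G) :=
  [set H | is_subgroup H /\
    exists2 c, H c & finite_set [set lcoset_of (gen [set c]) x | x in H]].

(* The homogeneous space G/H, as a discrete space. *)
Definition cosets H : set (set G) := range (lcoset_of H).

Definition homog H : topologicalType := discrete_topology (cosets H).

Definition to_homog H (x : G) : homog H :=
  SigSub (mem_set (imageT (lcoset_of H) x)).

End Groups.

Arguments locally_finite : clear implicits.
Arguments fin_subgroups : clear implicits.
Arguments vcyc_subgroups : clear implicits.

(* Since G is discrete, continuity of the action G * X -> X amounts to
   continuity of each translation. *)
Record gspace (G : groupType) := Gspace {
  gsort :> topologicalType;
  act : G -> gsort -> gsort;
  act1 : forall x, act 1%g x = x;
  actM : forall g h x, act (g * h)%g x = act g (act h x);
  act_continuous : forall g, continuous (act g) }.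

Definition fixed_points (G : groupType) (X : gspace G) (H : set G) : set X :=
  [set x | forall h, H h -> act h x = x].
Arguments fixed_points {G} X H.

Definition gmap (G : groupType) (X Y : gspace G) (f : X -> Y) : Prop :=
  continuous f /\ forall g x, f (act g x) = act g (f x).

Section Homotopy.
Context (R : realType).

Definition is_homotopy (X Y : topologicalType) (h : X * R -> Y)
    (f g : X -> Y) : Prop :=
  [/\ {within [set: X] `*` `[0, 1], continuous h},
      forall x, h (x, 0) = f x & forall x, h (x, 1) = g x].

Definition contractible (X : topologicalType) : Prop :=
  exists x0 : X, exists h : X * R -> X, is_homotopy h id (fun=> x0).

Definition ghomotopic (G : groupType) (X Y : gspace G) (f g : X -> Y) : Prop :=
  exists2 h : X * R -> Y, is_homotopy h f g &
    forall a x t, t \in `[0, 1] -> h (act a x, t) = act a (h (x, t)).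

Definition ghomotopy_equivalent (G : groupType) (X Y : gspace G) : Prop :=
  exists (f : X -> Y) (k : Y -> X),
    [/\ gmap f, gmap k, ghomotopic (k \o f) id & ghomotopic (f \o k) id].

End Homotopy.

(* The square
        A --a--> C
        |i       |j
        B --b--> P
   is a pushout of topological spaces. *)
Definition is_pushout (A B C P : topologicalType)
    (i : A -> B) (a : A -> C) (b : B -> P) (j : C -> P) : Prop :=
  [/\ continuous i, continuous a, continuous b & continuous j] /\
  b \o i = j \o a /\
  forall (Z : topologicalType) (u : B -> Z) (v : C -> Z),
    continuous u -> continuous v -> u \o i = v \o a ->
    exists! w : P -> Z, [/\ continuous w, w \o b = u & w \o j = v].

Section CW.
Context (R : realType).

Definition disk (n : nat) : set 'rV[R]_n :=
  [set x | \sum_(i < n) x ord0 i ^+ 2 <= 1].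
Arguments disk : clear implicits.

Definition sphere (n : nat) : set (disk n) :=
  [set x : disk n | \sum_(i < n) (set_val x : 'rV[R]_n) ord0 i ^+ 2 = 1].
Arguments sphere : clear implicits.

Section Cells.
Context {G : groupType} (n : nat) (I : choiceType) (H : I -> set G).

Definition disk_cells : topologicalType := {i : I & (homog (H i) * disk n)%type}.

Definition sphere_cells : topologicalType :=
  {i : I & (homog (H i) * sphere n)%type}.

Definition cell_boundary (p : sphere_cells) : disk_cells :=
  existT _ (projT1 p) ((projT2 p).1, set_val (projT2 p).2).

Definition cell_point (i : I) (x : G) (t : disk n) : disk_cells :=
  existT _ i (to_homog (H i) x, t).

End Cells.

(* B is obtained from A by attaching equivariant n-cells G/H_i * D^n along
   G/H_i * S^(n-1).  The map j is the inclusion of A into B; equivariance of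
   the attaching map q follows from that of the characteristic map Q. *)
Definition attaches_cells (G : groupType) (X : gspace G) (n : nat)
    (A B : set X) : Prop :=
  exists (I : choiceType) (H : I -> set G)
         (q : sphere_cells n H -> A) (Q : disk_cells n H -> B) (j : A -> B),
    [/\ forall i, is_subgroup (H i),
        forall g i x t, set_val (Q (cell_point H i (g * x)%g t)) =
                        act g (set_val (Q (cell_point H i x t))),
        forall x, set_val (j x) = set_val x &
        is_pushout (@cell_boundary G n I H) q Q j].

(* The n-th term of the filtration is the (n-1)-skeleton, so that the
   filtration starts with the empty (-1)-skeleton.  The last field says that
   X carries the colimit topology. *)
Record gcw (G : groupType) := Gcw {
  gcw_space :> gspace G;
  skel : nat -> set gcw_space;
  skel_act : forall n g x, skel n x -> skel n (act g x);
  skel0 : skel 0%N = set0;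
  skelS : forall n, attaches_cells n (skel n) (skel n.+1);
  skel_cover : \bigcup_n skel n = setT;
  skel_colim : forall U : set gcw_space,
    (forall n, open (set_val @^-1` U : set (skel n))) -> open U }.

Arguments skel {G} X n : rename.

(* The least n such that X is its own n-skeleton, +oo if there is none. *)
Definition gcw_dim (G : groupType) (X : gcw G) : \bar R :=
  ereal_inf [set n%:R%:E | n in [set n | skel X n.+1 = setT]].

Definition hdim (G : groupType) (X : gspace G) : \bar R :=
  ereal_inf
    [set d | exists2 Z : gcw G, ghomotopy_equivalent R Z X & d = gcw_dim Z].

(* X is a model for E_F(G); only used with F closed under conjugation and
   passage to subgroups. *)
Definition classifying_space (G : groupType) (F : set (set G))
    (X : gcw G) : Prop :=
  forall H, is_subgroup H ->
    (F H -> contractible R (fixed_points X H)) /\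
    (~ F H -> fixed_points X H = set0).

End CW.

(* Main.v *)
Require Import Defs.
From HB Require Import structures.
From mathcomp Require Import all_boot all_order all_algebra.
From mathcomp Require Import all_classical all_reals all_analysis.
From mathcomp Require Import generic_quotient zify ring lra.

Set Implicit Arguments.
Unset Strict Implicit.
Unset Printing Implicit Defensive.

Import Order.TTheory GRing.Theory Num.Theory.
Import numFieldNormedType.Exports.

Local Open Scope classical_set_scope.
Local Open Scope ring_scope.

(** A group that acts on a tree with all its elements elliptic and finitely
    many generators has a fixed vertex (Serre), and a one-dimensional model of
    a classifying space is a tree; the theorem is a comparison of the two trees
    for the families of finite and of virtually cyclic subgroups.

    Suppose first that both dimensions are one. A one-dimensional complex is
    the same as a graph with an action ([graph_of_complex]), and a contractible
    graph is a tree ([contractible_graph_tree]), so that each family is the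
    family of subgroups fixing a vertex of some tree ([model_tree]). On the
    tree of virtually cyclic subgroups every element is elliptic, hence every
    finitely generated subgroup has a fixed vertex
    ([fixed_vertex_of_elliptic]) and is virtually cyclic. If one of them is
    infinite it contains an element [c] of infinite order, and for each [g] the
    elements [c] and [g^-1 c g] lie in a common virtually cyclic group, so they
    have nontrivial powers which agree up to inversion. On the tree of finite
    subgroups [c] is hyperbolic and, by this commensurability, the whole group
    preserves its axis; as stabilizers are finite, [c] generates a subgroup of
    finite index ([finite_index_of_commensurated]). Then the group is itself
    virtually cyclic, the classifying space for virtually cyclic subgroups is
    equivalent to a point and its dimension is zero ([hdim_point]), a
    contradiction. The group is infinite for the same reason: otherwise the
    classifying space for finite subgroups would be a point.

    Conversely, in a locally finite group virtually cyclic subgroups are finite,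
    so the two classifying spaces have the same models. A countable locally
    finite group is the union of a chain of finite subgroups, and the telescope
    of the chain of coset spaces is a one-dimensional model
    ([tel_classifying]). Models being unique up to equivalence
    ([classifying_space_unique]), both dimensions are at most one, and they are
    not zero since a contractible complex of dimension zero is a fixed point
    ([model_dim0]), which an infinite group does not have.

    Uniqueness of models is obtained by extending maps cell by cell
    ([gmap_extension]); homotopies are treated as maps to a space of paths, so
    that only the universal property of the source itself is used. *)

(** * Trees *)

Section Walk.
Context {V : Type} (adj : V -> V -> Prop).

Fixpoint walk (n : nat) (x y : V) : Prop :=
  if n is n'.+1 then exists2 z, adj x z & walk n' z y else x = y.

(** A connected graph is a tree when each edge is the only edge that crosses
    some partition of the vertices into two parts: this is the form in which
    acyclicity is both obtained from the topology and used below. *)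
Definition is_tree : Prop :=
  [/\ forall x y, adj x y -> adj y x,
      forall x y, exists n, walk n x y &
      forall x y, adj x y -> exists f : V -> bool, f x != f y /\
        forall u v, adj u v -> f u != f v -> (u = x /\ v = y) \/ (u = y /\ v = x)].

Lemma walk_cat m n x y z : walk m x y -> walk n y z -> walk (m + n) x z.
Proof.
elim: m x => [x -> //|m IH x [t xt ty] yz]; by exists t => //; apply: IH.
Qed.

Lemma walk_rcons n x y z : walk n x y -> adj y z -> walk n.+1 x z.
Proof. by move=> xy yz; rewrite -addn1; apply: walk_cat xy _; exists z. Qed.

End Walk.

Section TreeMetric.
Context {V : Type} (adj : V -> V -> Prop) (T : is_tree adj).

Local Notation walk := (walk adj).

Let adj_sym x y : adj x y -> adj y x. Proof. by case: T => + _ _; apply. Qed.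

Lemma walk_sym n x y : walk n x y -> walk n y x.
Proof.
elim: n x => [//|n IH x [z xz zy]].
by apply: walk_rcons (adj_sym xz); apply: IH.
Qed.

Let walkb_ex x y : exists n, `[< walk n x y >].
Proof. by case: T => _ /(_ x y)[n w] _; exists n; apply/asboolP. Qed.

Definition dist (x y : V) : nat := ex_minn (walkb_ex x y).

Lemma dist_walk x y : walk (dist x y) x y.
Proof. by rewrite /dist; case: ex_minnP => n /asboolP. Qed.

Lemma dist_le n x y : walk n x y -> (dist x y <= n)%N.
Proof. by rewrite /dist; case: ex_minnP => m _ + w; apply; apply/asboolP. Qed.

Lemma distC x y : dist x y = dist y x.
Proof.
by apply/eqP; rewrite eqn_leq !dist_le //; apply: walk_sym; apply: dist_walk.
Qed.

Lemma dist_eq0 x y : dist x y = 0%N -> x = y.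
Proof. by move=> d0; have := dist_walk x y; rewrite d0. Qed.

Lemma distxx x : dist x x = 0%N.
Proof. by apply/eqP; rewrite -leqn0 dist_le. Qed.

Lemma dist_tri y x z : (dist x z <= dist x y + dist y z)%N.
Proof. by apply: dist_le; apply: walk_cat; apply: dist_walk. Qed.

Lemma dist_adj x y : adj x y -> (dist x y <= 1)%N.
Proof. by move=> xy; apply: dist_le; exists y. Qed.

Lemma dist_step n x y : dist x y = n.+1 -> exists2 z, adj x z & dist z y = n.
Proof.
move=> dn; have := dist_walk x y; rewrite dn => -[z xz zy]; exists z => //.
by have := dist_tri z x y; have := dist_adj xz; have := dist_le zy; lia.
Qed.

(** A walk to the side of [p] that starts on the other side has to traverse
    the edge from [x] to [p], so a shorter walk leads from [p] to its end. *)
Lemma walk_wall (f : V -> bool) p x w n y :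
  (forall u v, adj u v -> f u != f v -> (u = x /\ v = p) \/ (u = p /\ v = x)) ->
  f x != f p -> f w = f p -> f y != f w -> walk n y w -> (dist p w < n)%N.
Proof.
move=> fx xp wp; elim: n y => [y + yw|n IH y yw [z yz zw]].
  by rewrite yw eqxx.
have [zw'|zw'] := eqVneq (f z) (f w); last by have := IH _ zw' zw; lia.
have : f y != f z by rewrite zw'.
case/(fx _ _ yz) => -[ey ez]; first by rewrite -ez; have := dist_le zw; lia.
by move: xp; rewrite -ez zw' wp eqxx.
Qed.

(** The end of the edge which is on the side of [w] is the closer one: a walk
    from the other end crosses the wall, hence passes through it. *)
Lemma dist_adj_cases p x w : adj p x ->
  (dist x w = (dist p w).+1) \/ (dist p w = (dist x w).+1).
Proof.
move=> px; case: T => _ _ /(_ _ _ px)[f [fpx fU]].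
have bound : (dist x w <= dist p w + 1)%N /\ (dist p w <= dist x w + 1)%N.
  have := dist_tri p x w; have := dist_tri x p w.
  by have := dist_adj px; rewrite (distC x p); lia.
have [fw|fw] := eqVneq (f w) (f p).
  left; have := @walk_wall f p x w (dist x w) x _ _ fw.
  rewrite fw eq_sym => /(_ _ fpx fpx (dist_walk _ _)) lt.
  by have := lt (fun u v uv n => proj1 (or_comm _ _) (fU u v uv n)); lia.
have fw' : f w = f x by move: fpx fw; case: (f w) (f x) (f p) => [] [] [].
right; have := @walk_wall f x p w (dist p w) p fU fpx fw'.
by rewrite fw' => /(_ fpx (dist_walk _ _)); lia.
Qed.

(** Geodesics are unique: a walk from [y] to [w] would have to cross the wall of
    the edge from [p] to [x], and pass through [x] after fewer steps. *)
Lemma closer_neighbour_unique p x y w : adj p x -> adj p y ->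
  (dist x w < dist p w)%N -> (dist y w < dist p w)%N -> x = y.
Proof.
move=> px py xw yw; case: T => _ _ /(_ _ _ px)[f [fpx fU]].
apply: contrapT => xy.
have fw : f w != f p.
  apply/eqP => fw; have := @walk_wall f p x w (dist x w) x _ _ fw.
  rewrite fw eq_sym => /(_ _ fpx fpx (dist_walk _ _)) lt.
  by have := lt (fun u v uv n => proj1 (or_comm _ _) (fU u v uv n)); lia.
have fw' : f w = f x by move: fpx fw; case: (f w) (f x) (f p) => [] [] [].
have fy : f y = f p.
  apply/eqP; apply/negPn/negP; rewrite eq_sym => /(fU _ _ py)[[_ yx]|[px' _]].
    by apply: xy.
  by move: fpx; rewrite px' eqxx.
have := @walk_wall f x p w (dist y w) y fU fpx fw'.
rewrite fw' fy => /(_ fpx (dist_walk _ _)).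
by have := dist_tri x p w; have := dist_adj px; lia.
Qed.

(** Geodesics from [w] to [p] and from [p] to [q] concatenate to a geodesic when
    there is no backtracking at [p]: a first step back towards [w] would give
    some vertex two neighbours closer to [w]. *)
Lemma dist_leaving p x q w : adj p x -> dist p q = (dist x q).+1 ->
  (dist p w <= dist x w)%N -> dist w q = (dist w p + dist p q)%N.
Proof.
move En: (dist p q) => n.
elim: n p x En => [//|n IH p x pqn px [nxq] pw].
have xw : dist x w = (dist p w).+1 by case: (dist_adj_cases w px); lia.
case: n nxq IH pqn => [xq0|n xqn] IH pqn.
  have <- : x = q by apply: dist_eq0.
  by rewrite distC xw distC addn1.
have [y xy yq] := dist_step (esym xqn).
have yw : (dist x w <= dist y w)%N.
  rewrite leqNgt; apply/negP => yw.
  have : p = y.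
    apply: (@closer_neighbour_unique x p y w) => //; first exact: adj_sym.
    by rewrite xw.
  by move=> py; move: pqn; rewrite py yq; lia.
rewrite (IH x y (esym xqn) xy) ?yq // (distC w x) xw (distC p w); lia.
Qed.

(** Trees are 0-hyperbolic. The vertex [x] is moved towards [w] along an edge: if
    the edge separates [y] or [z] from [w], then geodesics pass through [x] and
    the claim holds as it stands, otherwise the distances from [x] all drop by
    one. *)
Lemma four_point x y z w :
  (dist x y + dist z w <= dist x z + dist y w)%N \/
  (dist x y + dist z w <= dist x w + dist y z)%N.
Proof.
move En: (dist x w) => n; elim: n x En => [|n IH x xw].
  by move=> x /dist_eq0 ->; left; rewrite (distC w z) (distC w y); lia.
have [x' xx' x'w] := dist_step xw.
have xx'w : dist x w = (dist x' w).+1 by rewrite xw x'w.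
have [xy|xy] := dist_adj_cases y xx'.
  left; have := dist_leaving xx' xx'w (w := y).
  rewrite xy leqnSn => /(_ isT) ->.
  by have := dist_tri x z w; rewrite (distC z x) (distC y x); lia.
have [xz|xz] := dist_adj_cases z xx'; last first.
  by have := IH x' x'w; lia.
right; have := dist_leaving xx' xx'w (w := z).
have := dist_leaving xx' xy (w := z).
by rewrite xz leqnSn => /(_ isT) + /(_ isT) ->; rewrite (distC y z) (distC z x); lia.
Qed.

(** A geodesic from [x] to [y] through [z] is the union of its two parts, as
    geodesics with given ends are unique. *)
Lemma interval_split x y z u :
  (dist x z + dist z y = dist x y)%N -> (dist x u + dist u y = dist x y)%N ->
  (dist x u + dist u z = dist x z)%N \/ (dist z u + dist u y = dist z y)%N.
Proof.
move=> xzy xuy; have := four_point x y u z.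
by have := dist_tri u x z; have := dist_tri u z y;
  rewrite (distC y z) (distC y u) (distC z u); lia.
Qed.

Lemma interval_inj x y u v :
  (dist x u + dist u y = dist x y)%N -> (dist x v + dist v y = dist x y)%N ->
  dist x u = dist x v -> u = v.
Proof.
move=> xuy xvy xuv; apply: dist_eq0; have := four_point x y u v.
by rewrite (distC y u) (distC y v); lia.
Qed.


End TreeMetric.

Lemma finite_set_inj {T U} (f : T -> U) (A : set T) :
  {in A &, injective f} -> finite_set (f @` A) -> finite_set A.
Proof. by move=> /inj_card_eq/eq_finite_set ->. Qed.

Lemma interval_finite {V} {adj : V -> V -> Prop} (T : is_tree adj) x y :
  finite_set [set u | (dist T x u + dist T u y = dist T x y)%N].
Proof.
apply: (@finite_set_inj _ _ (dist T x)).
  by move=> u v /set_mem xuy /set_mem xvy; apply: interval_inj xuy xvy.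
apply: sub_finite_set (finite_II (dist T x y).+1) => _ [u /= xuy <-] /=; lia.
Qed.

(** * Subgroups and generators *)

Section Subgroups.
Context {G : groupType}.
Implicit Types (H S : set G) (x y : G).

Lemma subgroupP H : is_subgroup H <-> H 1%g /\ forall x y, H x -> H y -> H (x / y)%g.
Proof.
rewrite /is_subgroup /group_closed; split=> -[H1 HD]; split.
- by move: H1; rewrite inE.
- by move=> x y Hx Hy; have := HD x y; rewrite !inE; apply.
- by rewrite inE.
- by move=> x y; rewrite !inE; apply: HD.
Qed.

Section Closure.
Context (H : set G) (gH : is_subgroup H).

Lemma subgroup1 : H 1%g. Proof. by case/subgroupP: gH. Qed.

Lemma subgroupV x : H x -> H x^-1%g.
Proof.
by case/subgroupP: gH => H1 HD Hx; rewrite -(mul1g x^-1%g); apply: HD.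
Qed.

Lemma subgroupM x y : H x -> H y -> H (x * y)%g.
Proof.
case/subgroupP: gH => H1 HD Hx Hy; rewrite -(invgK y); apply: HD => //.
exact: subgroupV.
Qed.

Lemma subgroupX n x : H x -> H (x ^+ n)%g.
Proof.
move=> Hx; elim: n => [|n IH]; first exact: subgroup1.
by rewrite expgS; apply: subgroupM.
Qed.

Lemma lcoset_ofP x y : lcoset_of H x = lcoset_of H y <-> H (x^-1 * y)%g.
Proof.
split=> [xy|Hxy].
  have [h Hh <-] : lcoset_of H x y.
    by rewrite xy; exists 1%g; rewrite ?mulg1 //; apply: subgroup1.
  by rewrite mulKg.
apply/seteqP; split=> _ [h Hh <-].
  exists ((x^-1 * y)^-1 * h)%g; last by rewrite invgM invgK !mulgA mulgV mul1g.
  by apply: subgroupM => //; apply: subgroupV.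
exists ((x^-1 * y) * h)%g; last by rewrite !mulgA mulgV mul1g.
exact: subgroupM.
Qed.

End Closure.

Lemma gen_subgroup S : is_subgroup (gen S).
Proof.
apply/subgroupP; split=> [A [gA _]|x y Sx Sy A [gA SA]].
  exact: subgroup1.
by apply: subgroupM => //; [exact: Sx|apply: subgroupV => //; exact: Sy].
Qed.

Lemma sub_gen S : S `<=` gen S.
Proof. by move=> x Sx A [_]; apply. Qed.

Lemma gen_sub S H : is_subgroup H -> S `<=` H -> gen S `<=` H.
Proof. by move=> gH SH x; apply. Qed.

Lemma gen_subset S S' : S `<=` S' -> gen S `<=` gen S'.
Proof.
by move=> SS'; apply: gen_sub (gen_subgroup _) _ => x /SS'; apply: sub_gen.
Qed.

Lemma mem_gen1 x : gen [set x] x. Proof. exact: sub_gen. Qed.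

Lemma gen1P x y :
  gen [set x] y <-> exists n, y = (x ^+ n)%g \/ y = (x ^- n)%g.
Proof.
split=> [|[n [->|->]]]; last 2 first.
- exact: (subgroupX (gen_subgroup _) _ (@mem_gen1 x)).
- apply: (subgroupV (gen_subgroup _)).
  exact: (subgroupX (gen_subgroup _) _ (@mem_gen1 x)).
apply: (@gen_sub [set x] [set y | exists n, y = (x ^+ n)%g \/ y = (x ^- n)%g]);
  last by move=> _ ->; exists 1%N; left.
have cP m n : exists k, (x ^+ m / x ^+ n)%g = (x ^+ k)%g \/ (x ^+ m / x ^+ n)%g = (x ^- k)%g.
  have [mn|mn] := leqP n m; first by exists (m - n)%N; left; rewrite expgnFr.
  by exists (n - m)%N; right; rewrite expgnFr 1?ltnW // invgM invgK.
apply/subgroupP; split=> [|_ _ [m [->|->]] [n [->|->]]].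
- by exists 0%N; left.
- exact: cP.
- by exists (m + n)%N; left; rewrite invgK expgnDr.
- by exists (n + m)%N; right; rewrite expgnDr invgM.
- have [k kP] := cP n m; exists k; rewrite invgK.
  by have -> // : (x ^- m * x ^+ n = x ^+ n / x ^+ m)%g;
    apply/commute_sym/commuteV/commuteX2.
Qed.

End Subgroups.

(** * Groups acting on trees *)

Section TreeAction.
Context {G : groupType} {V : Type} (adj : V -> V -> Prop) (T : is_tree adj).
Context (a : G -> V -> V).
Hypothesis a1 : forall v, a 1%g v = v.
Hypothesis aM : forall g h v, a (g * h)%g v = a g (a h v).
Hypothesis a_adj : forall g u v, adj u v -> adj (a g u) (a g v).

Local Notation d := (dist T).

Let aK g v : a g^-1%g (a g v) = v. Proof. by rewrite -aM mulVg a1. Qed.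
Let aVK g v : a g (a g^-1%g v) = v. Proof. by rewrite -aM mulgV a1. Qed.

Lemma dist_act g u v : d (a g u) (a g v) = d u v.
Proof.
have le h x y : (d (a h x) (a h y) <= d x y)%N.
  apply: dist_le; have := dist_walk T x y.
  move: (d x y) => n; elim: n x => [x ->|n IH x] //=.
  by case=> z xz zy; exists (a h z); [apply: a_adj|apply: IH].
by apply/eqP; rewrite eqn_leq le /= -{1}(aK g u) -{1}(aK g v) le.
Qed.

(** Take fixed vertices [p] of [A] and [q] of [B] as close as possible. Some
    element of [A] moves the first edge of the geodesic from [p] to [q], some
    element of [B] moves the last one, and the product of the two is then
    hyperbolic unless [p = q]. *)
Lemma common_fixed_vertex (A B : set G) (p0 q0 : V) :
  (forall g, A g -> a g p0 = p0) -> (forall g, B g -> a g q0 = q0) ->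
  (forall g h, A g -> B h -> exists w, a (g * h)%g w = w) ->
  exists v, forall g, A g \/ B g -> a g v = v.
Proof.
move=> Ap0 Bq0 AB.
pose P n := `[< exists p q, [/\ forall g, A g -> a g p = p,
                              forall g, B g -> a g q = q & d p q = n] >].
have exP : exists n, P n by exists (d p0 q0); apply/asboolP; exists p0, q0.
have [n /asboolP[p [q [Ap Bq pqn]]] nmin] := ex_minnP exP.
case: n pqn nmin => [|n] pqn nmin.
  exists p => g [/Ap//|Bg]; rewrite (dist_eq0 pqn); exact: Bq.
have [x px xq] := dist_step pqn.
have qpn : d q p = n.+1 by rewrite distC.
have [y qy yp] := dist_step qpn.
have [g Ag gx] : exists2 g, A g & a g x <> x.
  apply: contrapT => /forall2NP noA.
  suff /nmin : P n by rewrite ltnn.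
  apply/asboolP; exists x, q; split=> // g Ag.
  by have [//|/contrapT] := noA g.
have [h Bh hy] : exists2 h, B h & a h y <> y.
  apply: contrapT => /forall2NP noB.
  suff /nmin : P n by rewrite ltnn.
  apply/asboolP; exists p, y; split=> //; last by rewrite distC.
  by move=> h Bh; have [//|/contrapT] := noB h.
have [w ghw] := AB g h Ag Bh.
pose w' := a h w; have gw' : a g w' = w by rewrite -aM.
have wp : d w' p = d w p by rewrite -gw' -{2}(Ap g Ag) dist_act.
have wq : d w' q = d w q by rewrite /w' -{1}(Bq h Bh) dist_act.
(* At most one of [w] and [w'] is reached from [p] through [x], because [g]
   maps [w'] to [w] and moves [x]; their distances from [p] agree, and so do
   those from [q]. *)
have far_p : d w q = (d w p + n.+1)%N.
  rewrite -pqn; have [ww|ww] := leqP (d p w) (d x w).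
    by apply: dist_leaving px _ ww; rewrite pqn xq.
  rewrite -wq -wp; apply: (dist_leaving px); first by rewrite pqn xq.
  rewrite leqNgt; apply/negP => ww'; apply: gx.
  apply: (@closer_neighbour_unique _ _ T p _ _ w) => //.
  - by rewrite -{1}(Ap g Ag); apply: a_adj.
  - by rewrite -gw' dist_act -{1}(Ap g Ag) dist_act.
have far_q : d w p = (d w q + n.+1)%N.
  rewrite -qpn; have [ww|ww] := leqP (d q w) (d y w).
    by apply: dist_leaving qy _ ww; rewrite qpn yp.
  rewrite -wq -wp; apply: (dist_leaving qy); first by rewrite qpn yp.
  rewrite leqNgt; apply/negP => ww'; apply: hy.
  apply: (@closer_neighbour_unique _ _ T q _ _ w') => //.
  - by rewrite -{1}(Bq h Bh); apply: a_adj.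
  - by rewrite /w' dist_act -{1}(Bq h Bh) dist_act.
by move: far_p; rewrite far_q; lia.
Qed.

Lemma stabilizer_subgroup v : is_subgroup [set g | a g v = v].
Proof.
apply/subgroupP; split=> [|g h gv hv] //=.
by rewrite aM -{1}hv aK.
Qed.

(** Serre: a finitely generated group of elliptic elements is elliptic. The
    generators are added one at a time. *)
Lemma fixed_vertex_of_elliptic (S : set G) (v0 : V) : finite_set S ->
  (forall g, gen S g -> exists v, a g v = v) ->
  exists v, forall g, gen S g -> a g v = v.
Proof.
case/finite_seqP => s ->; elim: s => [|x s IH] ell.
  exists v0; apply: gen_sub; first exact: stabilizer_subgroup.
  by move=> g; rewrite /= in_nil.
have sub_s : gen [set` s] `<=` gen [set` x :: s].
  by apply: gen_subset => y /=; rewrite in_cons => ->; rewrite orbT.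
have sub_x : gen [set x] `<=` gen [set` x :: s].
  by apply: gen_subset => y -> /=; rewrite mem_head.
have [p ps] := IH (fun g sg => ell g (sub_s g sg)).
have [q qx] := ell x (sub_x _ (@mem_gen1 _ x)).
have qs : forall g, gen [set x] g -> a g q = q.
  by apply: gen_sub; [exact: stabilizer_subgroup|move=> _ ->].
have [g h sg xh|v vP] := common_fixed_vertex ps qs.
  apply: ell; apply: (subgroupM (gen_subgroup _)); [exact: sub_s|exact: sub_x].
exists v; apply: gen_sub; first exact: stabilizer_subgroup.
move=> g /=; rewrite in_cons => /orP[/eqP->|gs]; apply: vP.
  by right; apply: mem_gen1.
by left; apply: sub_gen.
Qed.

Section Hyperbolic.
Context (c : G) (c_free : forall n v, (0 < n)%N -> a (c ^+ n)%g v <> v) (v0 : V).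

(** A vertex which [c] moves as little as possible lies on the axis of [c]: the
    translates of the geodesic from [v] to [c v] fit together without
    backtracking. *)
Lemma axis_vertex : exists v l, (0 < l)%N /\ forall n, d v (a (c ^+ n)%g v) = (n * l)%N.
Proof.
pose P n := `[< exists v, d v (a c v) = n >].
have exP : exists n, P n by exists (d v0 (a c v0)); apply/asboolP; exists v0.
have [[|l] /asboolP[v vl] lmin] := ex_minnP exP.
  by case: (@c_free 1%N v) => //; rewrite expg1 -(dist_eq0 vl).
exists v, l.+1; split=> //.
have [x vx xl] := dist_step vl.
(* [x] follows [v] and [y] precedes [c v] on a geodesic; if [c x] were [y], then
   [c] would move [x] less than [v], or [c ^+ 2] would fix [v]. *)
have [y [cy yl xy]] : exists y, [/\ adj (a c v) y, (d y v <= l)%N & a c x <> y].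
  case: l vl lmin xl => [|l] vl lmin xl.
    exists v; rewrite distxx; have xcv := dist_eq0 xl; split=> //.
      by case: T => + _ _; apply; rewrite -xcv.
    by move=> ccv; case: (@c_free 2%N v) => //; rewrite expg2 aM -xcv.
  have clx : d (a c v) x = l.+1 by rewrite distC.
  have [y cy yx] := dist_step clx.
  exists y; split=> //.
    have := dist_tri T x y v; rewrite yx (distC T x v).
    by have := dist_adj T vx; lia.
  move=> cxy; have : P l by apply/asboolP; exists x; rewrite cxy distC.
  by move/lmin; lia.
have le n : (d v (a (c ^+ n)%g v) <= n * l.+1)%N.
  elim: n => [|n IH]; first by rewrite expg0 a1 distxx.
  have := dist_tri T (a (c ^+ n)%g v) v (a (c ^+ n.+1)%g v).
  by rewrite (expgSr c n) aM dist_act vl; lia.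
elim=> [|n IH]; first by rewrite expg0 a1 distxx.
case: n IH => [|n] IH; first by rewrite expg1 vl mul1n.
have step : d (a (c ^+ n.+1)%g v) (a (c ^+ n.+2)%g v) = l.+1.
  by rewrite (expgSr c n.+1) aM dist_act.
have stepx : d (a (c ^+ n.+1)%g x) (a (c ^+ n.+2)%g v) = l.
  by rewrite (expgSr c n.+1) aM dist_act.
rewrite (dist_leaving (a_adj (c ^+ n.+1)%g vx) (w := v)) ?step ?stepx //.
  by rewrite IH; lia.
rewrite leqNgt; apply/negP => xv; apply: xy.
suff : a (c ^+ n.+1)%g x = a (c ^+ n)%g y.
  by move/(congr1 (a (c ^+ n)^-1%g)); rewrite expgSr aM !aK.
apply: (@closer_neighbour_unique _ _ T (a (c ^+ n.+1)%g v) _ _ v) => //.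
- exact: a_adj.
- by rewrite expgSr aM; apply: a_adj.
- have := dist_tri T (a (c ^+ n)%g v) (a (c ^+ n)%g y) v.
  rewrite dist_act (distC T (a (c ^+ n)%g v) v) (distC T (a (c ^+ n.+1)%g v) v) IH.
  by have := le n; lia.
Qed.

(** The geodesic from [v] to [c ^+ n v] consists of translates of the geodesic
    from [v] to [c v]. *)
Lemma axis_interval v l n w : (forall k, d v (a (c ^+ k)%g v) = (k * l)%N) ->
  (d v w + d w (a (c ^+ n)%g v) = d v (a (c ^+ n)%g v))%N ->
  exists i x, w = a (c ^+ i)%g x /\ (d v x + d x (a c v) = d v (a c v))%N.
Proof.
move=> vl; elim: n => [|n IH] vw.
  exists 0%N, v; rewrite distxx add0n expg0 a1; split=> //.
  by apply/esym/(dist_eq0 (T := T)); move: vw; rewrite expg0 a1 distxx; lia.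
have vn : (d v (a (c ^+ n)%g v) + d (a (c ^+ n)%g v) (a (c ^+ n.+1)%g v) =
           d v (a (c ^+ n.+1)%g v))%N.
  by rewrite [in X in (_ + X)%N]expgSr aM dist_act !vl -[c in d v (a c v)]expg1 vl; lia.
have [/IH//|nw] := interval_split vn vw.
exists n, (a (c ^- n)%g w); rewrite aVK; split=> //.
rewrite -(dist_act (c ^+ n)%g v) -(dist_act (c ^+ n)%g (a (c ^- n)%g w)).
by rewrite -(dist_act (c ^+ n)%g v (a c v)) aVK -aM -expgSr.
Qed.

(** A vertex which some power of [c] moves like a vertex of the axis would is
    on the axis: far away, the geodesics joining its translates coincide with
    those joining the translates of [v]. *)
Lemma commensurable_axis v u l l' n : (0 < l')%N ->
  (forall k, d v (a (c ^+ k)%g v) = (k * l)%N) ->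
  (forall k, d u (a (c ^+ (n * k))%g u) = (k * l')%N) ->
  exists i j x, a (c ^+ i)%g u = a (c ^+ j)%g x /\
                (d v x + d x (a c v) = d v (a c v))%N.
Proof.
move=> l'0 vl ul'; pose D := d u v; pose k := D.+1; pose N := (n * k)%N.
pose U := a (c ^+ N)%g u; pose B := a (c ^+ N)%g U; pose B' := a (c ^+ (N + N))%g v.
have uU : d u U = (k * l')%N by rewrite /U ul'.
have UB : d U B = (k * l')%N by rewrite /B /U dist_act ul'.
have uB : d u B = (k * l' + k * l')%N.
  by rewrite /B /U -aM -expgnDr /N -mulnDr ul' mulnDl.
have BB' : d B B' = D by rewrite /B /U -aM -expgnDr dist_act.
have kl' : (D < k * l')%N by rewrite /k; nia.
(* [U] is the middle of [u] and [B]; replacing the ends by the nearby vertices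
   [v] and [B'] does not affect the geodesic around [U], as the ends are
   further than [D] from [U]. *)
have vUB : (d v U + d U B = d v B)%N.
  have := four_point T u B U v; have := dist_tri T U v B.
  by rewrite uB uU (distC T B U) (distC T B v) (distC T U v) -/D; lia.
have vUB' : (d v U + d U B' = d v B')%N.
  have := four_point T v B U B'; have := dist_tri T U v B'.
  by rewrite (distC T B U) BB'; lia.
have [i [x [Ux vx]]] := axis_interval vl vUB'.
by exists N, i, x.
Qed.

(** If the stabilizers are finite and every element commensurates [c], then all
    translates of a vertex of the axis of [c] lie on it; as [c] has only
    finitely many orbits there, it generates a subgroup of finite index. *)
Lemma finite_index_of_commensurated :
  (forall v, finite_set [set g | a g v = v]) ->
  (forall g, exists m n, [/\ (0 < m)%N, (0 < n)%N &
    (c ^+ n * g)%g = (g * c ^+ m)%g \/ (c ^+ n * g)%g = (g * c ^- m)%g]) ->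
  finite_set (range (lcoset_of (gen [set c]))).
Proof.
move=> fin_stab comm; have [v [l [l0 vl]]] := axis_vertex.
pose I := [set x | (d v x + d x (a c v) = d v (a c v))%N].
pose F := [set h | I (a h v)].
have finF : finite_set F.
  have : finite_set (\bigcup_(x in I) [set h | a h v = x]).
    apply: bigcup_finite => [|x _]; first exact: interval_finite.
    have [[h0 h0v]|nx] := pselect (exists h, a h v = x); last first.
      by apply: (sub_finite_set _ (finite_set0 _)) => h hv; apply: nx; exists h.
    apply: (sub_finite_set _ (finite_image (fun h => h0 * h)%g (fin_stab v))).
    move=> h /= hv; exists (h0^-1 * h)%g; last by rewrite mulVKg.
    by rewrite /= aM hv -h0v aK.
  by apply: sub_finite_set => h Fh; exists (a h v).
apply: (sub_finite_set _ (finite_image (fun h => lcoset_of (gen [set c]) h^-1%g) finF)).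
move=> _ [g _ <-]; have [m [n [m0 n0 cg]]] := comm g^-1%g.
have vlV k : d v (a (c ^- k)%g v) = (k * l)%N.
  by rewrite -(dist_act (c ^+ k)%g) aVK distC.
have ul k : d (a g^-1%g v) (a (c ^+ (n * k))%g (a g^-1%g v)) = (k * (m * l))%N.
  have [e|e] : (c ^+ (n * k) * g^-1)%g = (g^-1 * c ^+ (m * k))%g \/
               (c ^+ (n * k) * g^-1)%g = (g^-1 * c ^- (m * k))%g.
    rewrite !expgnA; case: cg => [cg|cg]; [left|right].
      elim: k => [|k IH]; first by rewrite !expg0 mul1g mulg1.
      by rewrite !expgSr -mulgA cg mulgA IH -mulgA.
    elim: k => [|k IH]; first by rewrite !expg0 invg1 mul1g mulg1.
    by rewrite expgSr -mulgA cg mulgA IH -mulgA -invgM -expgS.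
  - by rewrite -aM e aM dist_act vl mulnCA mulnA.
  - by rewrite -aM e aM dist_act vlV mulnCA mulnA.
have ml0 : (0 < m * l)%N by rewrite muln_gt0 m0.
have [i [j [x [e vx]]]] := commensurable_axis ml0 vl ul.
exists (c ^- j * c ^+ i * g^-1)%g.
  by rewrite /F /= !aM e aK.
apply/(lcoset_ofP (gen_subgroup _)).
rewrite invgK -mulgA mulVg mulg1.
apply: (subgroupM (gen_subgroup _)); apply/gen1P.
  by exists j; right.
by exists i; left.
Qed.

End Hyperbolic.
End TreeAction.

(** * Continuity *)

Lemma set_val_continuous {X : topologicalType} (A : set X) :
  continuous (set_val : A -> X).
Proof. exact: initial_continuous. Qed.

Lemma continuous_set_type {X Y : topologicalType} (A : set X) (f : Y -> A) :
  continuous (set_val \o f) -> continuous f.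
Proof. exact: continuous_comp_initial. Qed.

Lemma continuous_compT {X Y Z : topologicalType} (f : X -> Y) (g : Y -> Z) :
  continuous f -> continuous g -> continuous (g \o f).
Proof. by move=> cf cg x; apply: continuous_comp; [exact: cf|exact: cg]. Qed.

Lemma continuous_pair {X Y Z : topologicalType} (f : X -> Y) (g : X -> Z) :
  continuous f -> continuous g -> continuous (fun x => (f x, g x)).
Proof. by move=> cf cg x; apply: cvg_pair; [exact: cf|exact: cg]. Qed.

Lemma fst_continuous {X Y : topologicalType} : continuous (@fst X Y).
Proof. by move=> [x y]; apply: cvg_fst. Qed.

Lemma snd_continuous {X Y : topologicalType} : continuous (@snd X Y).
Proof. by move=> [x y]; apply: cvg_snd. Qed.

Lemma id_continuous {X : topologicalType} : continuous (@id X).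
Proof. by move=> x. Qed.

Lemma continuous_glue {X Y : topologicalType} (A B : set X) (f : X -> Y) :
  closed A -> closed B -> (forall x, A x \/ B x) ->
  {within A, continuous f} -> {within B, continuous f} -> continuous f.
Proof.
move=> cA cB AB fA fB; apply/continuous_subspace_setT.
have -> : [set: X] = A `|` B by apply/seteqP; split=> x // _; exact: AB.
exact: withinU_continuous.
Qed.

Lemma continuous_within_eq {X Y : topologicalType} (A : set X) (f g : X -> Y) :
  continuous g -> (forall x, A x -> f x = g x) -> {within A, continuous f}.
Proof.
move=> cg fg; apply: (@subspace_eq_continuous _ _ _ g).
  by move=> x /set_mem Ax; apply/esym/fg.
exact: continuous_subspaceT.
Qed.

Section RealValued.
Context {R : realType} {X : topologicalType}.
Implicit Types f g : X -> R.

Lemma addR_continuous f g :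
  continuous f -> continuous g -> continuous (fun x => f x + g x).
Proof. by move=> cf cg x; apply: cvgD; [exact: cf|exact: cg]. Qed.

Lemma oppR_continuous f : continuous f -> continuous (fun x => - f x).
Proof. by move=> cf x; apply: cvgN; exact: cf. Qed.

Lemma mulR_continuous f g :
  continuous f -> continuous g -> continuous (fun x => f x * g x).
Proof. by move=> cf cg x; apply: cvgM; [exact: cf|exact: cg]. Qed.

Lemma invR_continuous f :
  continuous f -> (forall x, f x != 0) -> continuous (fun x => (f x)^-1).
Proof. by move=> cf f0 x; apply: cvgV; [exact: f0|exact: cf]. Qed.

Lemma maxR_continuous f g :
  continuous f -> continuous g -> continuous (fun x => Num.max (f x) (g x)).
Proof. by move=> cf cg x; apply: continuous_max; [exact: cf|exact: cg]. Qed.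

Lemma minR_continuous f g :
  continuous f -> continuous g -> continuous (fun x => Num.min (f x) (g x)).
Proof. by move=> cf cg x; apply: continuous_min; [exact: cf|exact: cg]. Qed.

Lemma normR_continuous f : continuous f -> continuous (fun x => `|f x|).
Proof. by move=> cf x; apply: cvg_norm; exact: cf. Qed.

Lemma sqrtR_continuous f : continuous f -> continuous (fun x => Num.sqrt (f x)).
Proof. by move=> cf; apply: continuous_compT cf _; exact: sqrt_continuous. Qed.

Lemma closed_leR f g : continuous f -> continuous g -> closed [set x | f x <= g x].
Proof.
move=> cf cg.
have -> : [set x | f x <= g x] = (fun x => g x - f x) @^-1` [set t | 0 <= t].
  by apply/seteqP; split=> x /=; rewrite subr_ge0.
apply: preimage_closed; last exact: closed_ge.
by move=> x _; exact: (addR_continuous cg (oppR_continuous cf)).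
Qed.

Lemma closed_eqR f (a : R) : continuous f -> closed [set x | f x = a].
Proof.
move=> cf; apply: (@preimage_closed _ _ f [set t | t = a]); last exact: closed_eq.
by move=> x _; exact: cf.
Qed.

Lemma mx_continuous m n (f : X -> 'M[R]_(m, n)) :
  (forall i j, continuous (fun x => f x i j)) -> continuous f.
Proof.
move=> cf x A [P Pfx PA].
have : \forall y \near x, forall ij : 'I_m * 'I_n, P ij.1 ij.2 (f y ij.1 ij.2).
  by apply: filter_forall => -[i j] /=; exact: (cf i j x _ (Pfx i j)).
by apply: filterS => y Py; apply: PA => i j; exact: (Py (i, j)).
Qed.

End RealValued.

Definition clamp {R : realType} (t : R) : R := Num.max 0 (Num.min t 1).

Section Clamp.
Context {R : realType}.
Implicit Types t : R.

Lemma clamp_continuous : continuous (@clamp R).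
Proof.
apply: maxR_continuous; first exact: cst_continuous.
by apply: minR_continuous; [exact: id_continuous|exact: cst_continuous].
Qed.

Lemma clamp_itv t : 0 <= clamp t <= 1.
Proof. by rewrite /clamp le_max lexx /= ge_max ler01 ge_min lexx orbT. Qed.

Lemma clamp_id t : 0 <= t <= 1 -> clamp t = t.
Proof. by move=> /andP[t0 t1]; rewrite /clamp min_l // max_r. Qed.

Lemma clampK t : clamp (clamp t) = clamp t.
Proof. by rewrite clamp_id // clamp_itv. Qed.

Lemma clamp0 : clamp (0 : R) = 0. Proof. by rewrite clamp_id // lexx ler01. Qed.
Lemma clamp1 : clamp (1 : R) = 1. Proof. by rewrite clamp_id // lexx ler01. Qed.

Lemma clamp_ge1 t : 1 <= t -> clamp t = 1.
Proof. by move=> t1; rewrite /clamp min_r // max_r // ler01. Qed.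

Lemma clamp_le0 t : t <= 0 -> clamp t = 0.
Proof. by move=> t0; rewrite /clamp max_l // ge_min t0. Qed.

(** Homotopies are continuous at times in the unit interval; extended in this
    way to all times, they can be composed with other maps without regard to
    subspaces. *)
Lemma homotopy_clamp {X Y : topologicalType} (h : X * R -> Y) :
  {within [set: X] `*` `[0, 1], continuous h} ->
  continuous (fun p : X * R => h (p.1, clamp p.2)).
Proof.
move=> /subspace_sigL_continuousP ch.
have mem (p : X * R) : ([set: X] `*` `[0, 1]) (p.1, clamp p.2).
  by split=> //=; rewrite in_itv /= clamp_itv.
pose e (p : X * R) : [set: X] `*` (`[0, 1] : set R) := SigSub (mem_set (mem p)).
rewrite (_ : (fun p => _) = sigL ([set: X] `*` `[0, 1]) h \o e) //.
apply: continuous_compT ch; apply: continuous_set_type.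
apply: continuous_pair; first exact: fst_continuous.
by apply: continuous_compT; [exact: snd_continuous|exact: clamp_continuous].
Qed.

End Clamp.

(** The contraction is extended by constants to all times after the end, which
    makes it continuous on the whole product. *)
Lemma contractibleP {R : realType} (Y : topologicalType) : contractible R Y ->
  exists (y0 : Y) (h : Y * R -> Y), [/\ continuous h, forall y, h (y, 0) = y &
    forall y t, 1 <= t -> h (y, t) = y0].
Proof.
case=> y0 [h [ch h0 h1]]; exists y0, (fun p => h (p.1, clamp p.2)); split=> //.
- exact: homotopy_clamp.
- by move=> y /=; rewrite clamp0.
- by move=> y t t1 /=; rewrite clamp_ge1.
Qed.

(** * Extension over disks *)

(** Radial extension: [rho] is the distance from the centre and [p] the
    projection to the boundary [B]. The contraction of the target runs from the
    boundary to half-way to the centre, and the extension is constant further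
    inside. *)
Lemma cone_extension {R : realType} (D Y : topologicalType) (B : set D)
    (rho : D -> R) (p : D -> D) (f : D -> Y) :
  contractible R Y -> continuous rho -> continuous p ->
  (forall x, 1 / 2 <= rho x -> B (p x)) ->
  (forall x, B x -> p x = x /\ rho x = 1) ->
  {within B, continuous f} ->
  exists e : D -> Y, continuous e /\ forall x, B x -> e x = f x.
Proof.
case/contractibleP => y0 [h [ch h0 h1]] crho cp pB Bp cf.
exists (fun x => h (f (p x), 2 - 2 * rho x)); split; last first.
  by move=> x /Bp[-> ->]; rewrite mulr1 subrr h0.
have crho2 : continuous (fun x => 2 - 2 * rho x).
  apply: addR_continuous; first exact: cst_continuous.
  apply: oppR_continuous; apply: mulR_continuous => //; exact: cst_continuous.
apply: (@continuous_glue _ _ [set x | rho x <= 1 / 2] [set x | 1 / 2 <= rho x]).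
- by apply: closed_leR => //; exact: cst_continuous.
- by apply: closed_leR => //; exact: cst_continuous.
- by move=> x /=; case: (leP (rho x) (1 / 2)) => [|/ltW]; [left|right].
- apply: (@continuous_within_eq _ _ _ _ (fun=> y0)); first exact: cst_continuous.
  by move=> x /= rx; rewrite h1 //; lra.
- apply/subspace_sigL_continuousP.
  pose q (x : [set x | 1 / 2 <= rho x]) : B := SigSub (mem_set (pB _ (set_valP x))).
  have cq : continuous q.
    apply: continuous_set_type.
    exact: (continuous_compT (@set_val_continuous _ _) cp).
  have /subspace_sigL_continuousP cfB := cf.
  have -> : sigL [set x | 1 / 2 <= rho x] (fun x => h (f (p x), 2 - 2 * rho x)) =
      h \o (fun x => (sigL B f (q x), 2 - 2 * rho (set_val x))) by [].
  apply: continuous_compT ch; apply: continuous_pair.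
    exact: continuous_compT cq cfB.
  exact: (continuous_compT (@set_val_continuous _ _) crho2).
Qed.

Section Disk.
Context {R : realType} (n : nat).

Definition enorm (x : 'rV[R]_n) : R := Num.sqrt (\sum_(i < n) x ord0 i ^+ 2).

Lemma sumsq_ge0 (x : 'rV[R]_n) : 0 <= \sum_(i < n) x ord0 i ^+ 2.
Proof. by apply: sumr_ge0 => i _; rewrite sqr_ge0. Qed.

Lemma enorm_ge0 x : 0 <= enorm x. Proof. exact: sqrtr_ge0. Qed.

Lemma enormZ (a : R) x : 0 <= a -> enorm (a *: x) = a * enorm x.
Proof.
move=> a0; rewrite /enorm (_ : \sum_i _ = a ^+ 2 * \sum_(i < n) x ord0 i ^+ 2).
  by rewrite sqrtrM ?sqr_ge0 // sqrtr_sqr ger0_norm.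
by rewrite mulr_sumr; apply: eq_bigr => i _; rewrite mxE exprMn.
Qed.

Lemma enorm_continuous : continuous enorm.
Proof.
apply: sqrtR_continuous; apply: continuous_big => [|i _].
  exact: (addR_continuous fst_continuous snd_continuous).
by apply: (@mulR_continuous _ _ (fun y : 'rV[R]_n => y ord0 i)
  (fun y : 'rV[R]_n => y ord0 i)) => //; exact: coord_continuous.
Qed.

Lemma disk_enorm (x : 'rV[R]_n) : @disk R n x <-> enorm x <= 1.
Proof.
rewrite /disk /= /enorm -{2}(sqrtr1 R).
by split=> [|]; rewrite ler_sqrt.
Qed.

Lemma sphere_enorm (x : @disk R n) : @sphere R n x <-> enorm (set_val x) = 1.
Proof.
rewrite /sphere /= /enorm; split=> [->|h]; first exact: sqrtr1.
by rewrite -[LHS]sqr_sqrtr ?sumsq_ge0 // h expr1n.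
Qed.

Lemma disk_ret_subproof (x : 'rV[R]_n) : @disk R n ((Num.max 1 (enorm x))^-1 *: x).
Proof.
apply/disk_enorm; rewrite enormZ ?invr_ge0 ?le_max ?ler01 //.
by rewrite mulrC ler_pdivrMr ?mul1r ?lt_max ?ltr01 // le_max lexx orbT.
Qed.

(** The radial retraction of the whole space onto the disk. *)
Definition disk_ret (x : 'rV[R]_n) : @disk R n := SigSub (mem_set (disk_ret_subproof x)).

Lemma disk_retE x : set_val (disk_ret x) = (Num.max 1 (enorm x))^-1 *: x.
Proof. by []. Qed.

Lemma scale_continuous_mx {X : topologicalType} (a : X -> R) (f : X -> 'rV[R]_n) :
  continuous a -> continuous f -> continuous (fun x => a x *: f x).
Proof.
move=> ca cf; apply: mx_continuous => i j.
under [X in continuous X]eq_fun do rewrite mxE.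
by apply: mulR_continuous => //; exact: (continuous_compT cf (@coord_continuous _ _ _ i j)).
Qed.

Lemma disk_ret_continuous : continuous disk_ret.
Proof.
apply: continuous_set_type; apply: scale_continuous_mx; last exact: id_continuous.
apply: invR_continuous => [|x]; last by rewrite gt_eqF // lt_max ltr01.
by apply: maxR_continuous; [exact: cst_continuous|exact: enorm_continuous].
Qed.

Lemma disk_ret_id (x : @disk R n) : disk_ret (set_val x) = x.
Proof.
apply/val_inj => /=; have /disk_enorm x1 : @disk R n (set_val x) by exact: set_valP.
by rewrite max_l // invr1 scale1r.
Qed.

Lemma disk_ret_enorm (x : 'rV[R]_n) : 1 <= enorm x -> enorm (set_val (disk_ret x)) = 1.
Proof.
move=> x1; rewrite disk_retE max_r // enormZ ?invr_ge0 ?enorm_ge0 // mulVf //.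
by rewrite gt_eqF // (lt_le_trans ltr01).
Qed.

Definition disk0 : @disk R n := disk_ret 0.

Local Notation dnorm x := (enorm (set_val x)).

Lemma dnorm_continuous : continuous (fun x : @disk R n => dnorm x).
Proof. exact: (continuous_compT (@set_val_continuous _ _) enorm_continuous). Qed.

Lemma dnorm_le1 (x : @disk R n) : dnorm x <= 1.
Proof. by apply/disk_enorm; exact: set_valP. Qed.

Lemma closed_sphere : closed (@sphere R n).
Proof.
have -> : @sphere R n = [set x : @disk R n | dnorm x = 1].
  by apply/seteqP; split=> x /sphere_enorm.
exact: (closed_eqR dnorm_continuous).
Qed.

(** The cylinder is treated as a ball with centre [(0, 1/2)]: [rho] is the
    distance from the centre and [proj] the projection to the boundary. The
    lower bound in [sigma] makes [proj] continuous at the centre too. *)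
Let rho (x : @disk R n * R) : R := Num.max (dnorm x.1) `|2 * clamp x.2 - 1|.
Let sigma (x : @disk R n * R) : R := Num.max (rho x) (1 / 2).
Let proj (x : @disk R n * R) : @disk R n * R :=
  (disk_ret ((sigma x)^-1 *: set_val x.1),
   clamp (1 / 2 + (2 * clamp x.2 - 1) * (2 * sigma x)^-1)).

Let cclamp : continuous (fun x : @disk R n * R => 2 * clamp x.2 - 1).
Proof.
apply: addR_continuous; last exact: cst_continuous.
apply: mulR_continuous; first exact: cst_continuous.
exact: (continuous_compT snd_continuous clamp_continuous).
Qed.

Let crho : continuous rho.
Proof.
apply: maxR_continuous; last exact: (normR_continuous cclamp).
exact: (continuous_compT fst_continuous dnorm_continuous).
Qed.

Let sigma_gt0 x : 0 < sigma x. Proof. by rewrite /sigma lt_max divr_gt0 ?orbT. Qed.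

Let csigma : continuous sigma.
Proof. by apply: (maxR_continuous crho); exact: cst_continuous. Qed.

Let cproj : continuous proj.
Proof.
apply: continuous_pair.
  apply: (continuous_compT _ disk_ret_continuous); apply: scale_continuous_mx.
    by apply: (invR_continuous csigma) => x; rewrite gt_eqF.
  exact: (continuous_compT fst_continuous (@set_val_continuous _ _)).
apply: (continuous_compT _ clamp_continuous).
apply: addR_continuous; first exact: cst_continuous.
apply: (mulR_continuous cclamp); apply: invR_continuous => [|x].
  by apply: mulR_continuous; [exact: cst_continuous|exact: csigma].
by rewrite gt_eqF // mulr_gt0.
Qed.

Definition cylinder_boundary : set (@disk R n * R) :=
  [set x | @sphere R n x.1 /\ 0 <= x.2 <= 1] `|` ([set x | x.2 = 0] `|` [set x | x.2 = 1]).

Let proj_boundary x : 1 / 2 <= rho x -> cylinder_boundary (proj x).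
Proof.
move=> rx; have srho : sigma x = rho x by rewrite /sigma max_l.
have r0 : 0 < rho x by rewrite -srho.
have [xr|rx'] := leP `|2 * clamp x.2 - 1| (dnorm x.1).
  have re : rho x = dnorm x.1 by rewrite /rho max_l.
  left; split; last exact: clamp_itv.
  apply/sphere_enorm; apply: disk_ret_enorm.
  by rewrite enormZ ?invr_ge0 ?(ltW (sigma_gt0 x)) // srho re mulVf // -re gt_eqF.
have re : rho x = `|2 * clamp x.2 - 1| by rewrite /rho max_r // ltW.
right; rewrite /proj /= srho.
have -> : (2 * rho x)^-1 = (rho x)^-1 / 2 by rewrite invfM mulrC.
have [t0|t0] := leP 0 (2 * clamp x.2 - 1); [right|left].
  have -> : (2 * clamp x.2 - 1) = rho x by rewrite re ger0_norm.
  by rewrite mulrA mulfV ?gt_eqF // clamp_ge1 //; lra.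
have -> : (2 * clamp x.2 - 1) = - rho x by rewrite re ltr0_norm // opprK.
by rewrite mulNr mulrA mulfV ?gt_eqF // clamp_le0 //; lra.
Qed.

Let proj_id x : cylinder_boundary x -> proj x = x /\ rho x = 1.
Proof.
move=> Bx; have cx : clamp x.2 = x.2.
  by case: Bx => [[_]|[|] /= ->]; [exact: clamp_id|exact: clamp0|exact: clamp1].
have x01 : 0 <= x.2 <= 1 by rewrite -cx clamp_itv.
have rx : rho x = 1.
  have n1 : `|2 * x.2 - 1| <= 1 by rewrite ler_norml; move/andP: x01 => [? ?]; lra.
  rewrite /rho cx; case: Bx => [[/sphere_enorm -> _]|[|] /= ->]; first by rewrite max_l.
    by rewrite mulr0 sub0r normrN1 max_r // dnorm_le1.
  by rewrite mulr1 (_ : 2 - 1 = 1 :> R) ?normr1 ?max_r ?dnorm_le1 //; lra.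
split=> //; rewrite /proj /sigma rx max_l; last by lra.
rewrite invr1 scale1r disk_ret_id mulr1 cx (_ : _ + _ = x.2) ?cx; last by lra.
by case: (x).
Qed.

Lemma disk_extension (Y : topologicalType) (f : @sphere R n -> Y) :
  contractible R Y -> continuous f ->
  exists e : @disk R n -> Y, continuous e /\ forall s : @sphere R n, e (set_val s) = f s.
Proof.
move=> cY cf; have [y0 _] := contractibleP cY.
pose s (x : @disk R n) : R := Num.max (dnorm x) (1 / 2).
have s0 x : 0 < s x by rewrite /s lt_max divr_gt0 ?orbT.
have cs : continuous s by apply: (maxR_continuous dnorm_continuous); exact: cst_continuous.
pose p x := disk_ret ((s x)^-1 *: set_val x).
have cp : continuous p.
  apply: (continuous_compT _ disk_ret_continuous); apply: scale_continuous_mx.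
    by apply: (invR_continuous cs) => x; rewrite gt_eqF.
  exact: set_val_continuous.
have cF : {within @sphere R n, continuous (valL_ y0 f)}.
  exact/subspace_valL_continuousP'.
have pB x : 1 / 2 <= dnorm x -> sphere (p x).
  move=> rx; apply/sphere_enorm/disk_ret_enorm.
  by rewrite enormZ ?invr_ge0 ?(ltW (s0 x)) // /s max_l // mulVf // gt_eqF //; lra.
have pK x : sphere x -> p x = x /\ dnorm x = 1.
  move=> /sphere_enorm x1; split=> //; rewrite /p /s x1 max_l; last by lra.
  by rewrite invr1 scale1r disk_ret_id.
have [e [ce eB]] := cone_extension cY dnorm_continuous cp pB pK cF.
exists e; split=> // t; have st : sphere (set_val t) := set_valP t; rewrite eB //.
by have /(congr1 (fun g => g t)) := valLK y0 f.
Qed.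

(** The map is prescribed on the boundary of the cylinder, which is the union of
    the cylinder over the sphere and the two ends; the prescriptions are glued
    there and extended radially. *)
Lemma cylinder_extension (Y : topologicalType) (f : @sphere R n * R -> Y)
    (f0 f1 : @disk R n -> Y) :
  contractible R Y -> continuous f -> continuous f0 -> continuous f1 ->
  (forall s, f (s, 0) = f0 (set_val s)) -> (forall s, f (s, 1) = f1 (set_val s)) ->
  exists e : @disk R n * R -> Y, [/\ continuous e, forall x, e (x, 0) = f0 x,
    forall x, e (x, 1) = f1 x &
    forall s t, 0 <= t <= 1 -> e (set_val s, t) = f (s, t)].
Proof.
move=> cY cf cf0 cf1 ff0 ff1; have [y0 _] := contractibleP cY.
pose F (x : @disk R n * R) : Y :=
  match pselect (@sphere R n x.1) with
  | left h => f (SigSub (mem_set h), x.2)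
  | right _ => if x.2 == 0 then f0 x.1 else f1 x.1
  end.
have F0 x : F (x, 0) = f0 x.
  by rewrite /F; case: pselect => [h|]; rewrite ?ff0 //= eqxx.
have F1 x : F (x, 1) = f1 x.
  by rewrite /F; case: pselect => [h|]; rewrite ?ff1 //= oner_eq0.
have Fs s t : F (set_val s, t) = f (s, t).
  rewrite /F; case: pselect => [h|]; last by case; exact: set_valP.
  by congr (f (_, _)); apply/val_inj.
have cF : {within cylinder_boundary, continuous F}.
  apply: withinU_continuous; last apply: withinU_continuous.
  - have -> : [set x : @disk R n * R | @sphere R n x.1 /\ 0 <= x.2 <= 1] =
        (fst @^-1` @sphere R n) `&` ([set x | 0 <= x.2] `&` [set x | x.2 <= 1]).
      by apply/seteqP; split=> x /= => [[? /andP[]]|[? [-> ->]]].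
    apply: closedI; last apply: closedI.
    + apply: (preimage_closed _ closed_sphere) => x _; exact: fst_continuous.
    + by apply: closed_leR; [exact: cst_continuous|exact: snd_continuous].
    + by apply: closed_leR; [exact: snd_continuous|exact: cst_continuous].
  - by apply: closedU; apply: closed_eqR; exact: snd_continuous.
  - apply/subspace_sigL_continuousP; set C := mkset _.
    pose q (z : C) : @sphere R n * R :=
      (SigSub (mem_set (proj1 (set_valP z))), (set_val z).2).
    have -> : sigL C F = f \o q.
      apply/funext => z; rewrite /sigL /= [set_val z]surjective_pairing.
      exact: (Fs (q z).1 (q z).2).
    apply: (continuous_compT _ cf); apply: continuous_pair.
      apply: continuous_set_type.
      exact: (continuous_compT (@set_val_continuous _ _) fst_continuous).
    exact: (continuous_compT (@set_val_continuous _ _) snd_continuous).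
  - exact: (closed_eqR snd_continuous).
  - exact: (closed_eqR snd_continuous).
  - apply: (continuous_within_eq (continuous_compT fst_continuous cf0)).
    by move=> [x t] /= ->; rewrite F0.
  - apply: (continuous_within_eq (continuous_compT fst_continuous cf1)).
    by move=> [x t] /= ->; rewrite F1.
have [e [ce eB]] := cone_extension cY crho cproj proj_boundary proj_id cF.
exists e; split=> //.
- by move=> x; rewrite eB ?F0 //; right; left.
- by move=> x; rewrite eB ?F1 //; right; right.
- by move=> s t t01; rewrite eB ?Fs //; left; split=> //; exact: set_valP.
Qed.

End Disk.

(** * Pushouts and cells *)

Section Indiscrete.

Definition indiscrete_of (T : Type) : T -> unit := fun=> tt.

(** Every map into this space is continuous; maps into it recover the
    underlying sets of a space from its universal property. *)
Definition indiscrete (T : choiceType) : topologicalType :=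
  initial_topology (@indiscrete_of T : T -> discrete_topology unit).

Lemma indiscrete_continuous {X : topologicalType} (T : choiceType) (f : X -> indiscrete T) :
  continuous f.
Proof. by apply: continuous_comp_initial => x; exact: cst_continuous. Qed.

End Indiscrete.

Section PushoutSet.
Context {A B C P : topologicalType} {i : A -> B} {a : A -> C} {b : B -> P} {j : C -> P}.
Hypothesis push : is_pushout i a b j.

(** The indicator function of the union of the images and the constant function
    agree on both pieces, hence everywhere by uniqueness. *)
Lemma pushout_cover (x : P) : (exists y, b y = x) \/ (exists z, j z = x).
Proof.
case: push => _ [_ /(_ (indiscrete bool) (fun=> true) (fun=> true))].
have ic := fun X => @indiscrete_continuous X bool.
case=> // w [_ wU].
have wT := wU (fun=> true : indiscrete bool) (And3 (ic _ _) erefl erefl).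
pose v x := `[< (exists y, b y = x) \/ (exists z, j z = x) >] : indiscrete bool.
have wv : w = v.
  apply: wU; split=> //; apply/funext => y /=; apply/asboolP.
    by left; exists y.
  by right; exists y.
by apply/asboolP; rewrite -/(v x) -wv wT.
Qed.

Lemma pushout_set_map (T : choiceType) (u : B -> T) (v : C -> T) :
  u \o i = v \o a -> exists w : P -> T, w \o b = u /\ w \o j = v.
Proof.
move=> uv; case: push => _ [_ /(_ (indiscrete T) u v)].
case; [exact: indiscrete_continuous..|exact: uv|].
by move=> w [[_ wb wj] _]; exists w.
Qed.

Lemma pushout_map (Z : topologicalType) (u : B -> Z) (v : C -> Z) :
  continuous u -> continuous v -> u \o i = v \o a ->
  exists w : P -> Z, [/\ continuous w, w \o b = u & w \o j = v].
Proof.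
by move=> cu cv uv; case: push => _ [_ /(_ Z u v cu cv uv)][w [wP _]]; exists w.
Qed.

End PushoutSet.

(** This is how spaces of cells are handled one disk at a time. *)
Lemma discrete_prod_continuous {T : choiceType} {X Y : topologicalType}
    (f : discrete_topology T * X -> Y) :
  (forall C, continuous (fun x => f (C, x))) -> continuous f.
Proof.
move=> cf [C x] U fU.
exists ([set C], (fun y => f (C, y)) @^-1` U) => /=.
  split; last exact: (cf C x U fU).
  by rewrite nbhs_principalE.
by move=> [C' y] [/= -> ].
Qed.

Section Homog.
Context {G : groupType} {H : set G} (gH : is_subgroup H).

Lemma to_homogP x y : to_homog H x = to_homog H y <-> H (x^-1 * y)%g.
Proof.
rewrite -(lcoset_ofP gH); split=> [/(congr1 val)//|xy]; exact/val_inj.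
Qed.

Lemma to_homog_surj (C : homog H) : exists x, to_homog H x = C.
Proof.
by case: C => C CP; case: (set_mem CP) => x _ xC; exists x; apply/val_inj.
Qed.

Definition homog_repr (C : homog H) : G := projT1 (cid (to_homog_surj C)).

Lemma homog_reprK C : to_homog H (homog_repr C) = C.
Proof. by rewrite /homog_repr; case: cid. Qed.

Lemma homog_repr_to x : exists2 h, H h & homog_repr (to_homog H x) = (x * h)%g.
Proof.
exists (x^-1 * homog_repr (to_homog H x))%g; last by rewrite mulVKg.
by apply/to_homogP; rewrite homog_reprK.
Qed.

End Homog.

Section Cells.
Context {R : realType} {G : groupType} {n : nat} {I : choiceType} {H : I -> set G}.

Lemma disk_cells_continuous {Y : topologicalType} (f : disk_cells R n H -> Y) :
  (forall i C, continuous (fun t => f (existT _ i (C, t)))) -> continuous f.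
Proof.
move=> cf [i p] U fU.
exact: (@discrete_prod_continuous (cosets (H i)) _ _ (fun p => f (existT _ i p)) (cf i) p U fU).
Qed.

Lemma disk_cell_continuous i C :
  continuous (fun t => existT _ i (C, t) : disk_cells R n H).
Proof.
apply: (continuous_compT (g := existT _ i)); last exact: existT_continuous.
by apply: continuous_pair; [exact: cst_continuous|exact: id_continuous].
Qed.

Lemma sphere_cell_continuous i C :
  continuous (fun t => existT _ i (C, t) : sphere_cells R n H).
Proof.
apply: (continuous_compT (g := existT _ i)); last exact: existT_continuous.
by apply: continuous_pair; [exact: cst_continuous|exact: id_continuous].
Qed.

End Cells.

(** * Equivariant maps out of a complex *)

Section Attach.
Context {R : realType} {G : groupType} (X : gcw R G).

Lemma skel_succ n (x : X) : skel n x -> skel n.+1 x.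
Proof.
move=> nx; have [I [H [q [Q [j [_ _ jE _]]]]]] := skelS X n.
pose y : @skel R G X n := SigSub (mem_set nx).
by have : skel n.+1 (set_val (j y)) := set_valP _; rewrite jE.
Qed.

Lemma skel_le m n (x : X) : (m <= n)%N -> skel m x -> skel n x.
Proof.
move=> /subnK <-; elim: (n - m)%N => [//|k IH] mx.
by rewrite addSn; apply: skel_succ; apply: IH.
Qed.

Definition skel_sub n (g : G) (x : @skel R G X n) : @skel R G X n :=
  SigSub (mem_set (skel_act g (set_valP x))).

(** The data of a partial equivariant map on a skeleton; [rel] is the
    constraint which the map has to satisfy pointwise. *)
Definition partial_gmap (E : gspace G) (rel : X -> E -> Prop) n
    (f : @skel R G X n -> E) : Prop :=
  [/\ continuous f, forall g x, f (skel_sub g x) = act g (f x) &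
      forall x, rel (set_val x) (f x)].

(** Cell by cell, an equivariant map extends as soon as it extends over each
    disk fixed by the stabilizer of the cell. *)
Definition extendable (E : gspace G) (rel : X -> E -> Prop) : Prop :=
  forall n (H : set G) (c : @disk R n -> X) (f : @sphere R n -> E),
    is_subgroup H -> continuous c -> continuous f ->
    (forall t, fixed_points X H (c t)) -> (forall s, fixed_points E H (f s)) ->
    (forall s, rel (c (set_val s)) (f s)) ->
    exists e : @disk R n -> E, [/\ continuous e,
      forall t, fixed_points E H (e t), forall s, e (set_val s) = f s &
      forall t, rel (c t) (e t)].

Context (E : gspace G) (rel : X -> E -> Prop).
Hypothesis rel_act : forall g x y, rel x y -> rel (act g x) (act g y).
Hypothesis ext : extendable rel.

(** For each cell, the extension over the disk over the trivial coset is chosen,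
    and equivariance dictates the other disks; it is consistent as the chosen
    extension takes values fixed by the stabilizer of the cell. *)
Lemma partial_gmap_extend n (f : @skel R G X n -> E) : partial_gmap rel f ->
  exists f' : @skel R G X n.+1 -> E, partial_gmap rel f' /\
    forall x y, set_val x = set_val y -> f' y = f x.
Proof.
case=> cf fa fr; have [I [H [q [Q [j [gH QE jE push]]]]]] := skelS X n.
have [[ci cq cQ cj] [square _]] := push.
pose c i t := set_val (Q (cell_point H i 1%g t)).
have QcE i x t : set_val (Q (cell_point H i x t)) = act x (c i t).
  by rewrite /c -QE mulg1.
have c_fix i t : fixed_points X (H i) (c i t).
  move=> h Hh; rewrite -QcE /c; congr (set_val (Q (existT _ i (_, t)))).
  apply/(to_homogP (gH i)); rewrite mulg1; exact: subgroupV.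
have cc i : continuous (c i).
  have cQi : continuous (fun t => Q (cell_point H i 1%g t)).
    exact: (continuous_compT (@disk_cell_continuous _ _ _ _ _ i (to_homog (H i) 1%g)) cQ).
  exact: (continuous_compT cQi (@set_val_continuous _ _)).
have qE i x s : q (existT _ i (to_homog (H i) x, s)) =
    skel_sub x (q (existT _ i (to_homog (H i) 1%g, s))).
  apply/val_inj; rewrite -!set_valE -jE.
  have := congr1 (fun F => F (existT _ i (to_homog (H i) x, s))) square.
  move=> /= <-; rewrite -[LHS]/(set_val (Q (cell_point H i x (set_val s)))) QcE.
  rewrite -[RHS]/(act x (set_val (q (existT _ i (to_homog (H i) 1%g, s))))) -jE.
  by have /= <- := congr1 (fun F => F (existT _ i (to_homog (H i) 1%g, s))) square.
pose phi i s := f (q (existT _ i (to_homog (H i) 1%g, s))).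
have cphi i : continuous (phi i).
  apply: (continuous_compT _ cf).
  exact: (continuous_compT (@sphere_cell_continuous _ _ _ _ _ i (to_homog (H i) 1%g)) cq).
have phi_fix i s : fixed_points E (H i) (phi i s).
  move=> h Hh; rewrite /phi -fa -qE; congr (f (q (existT _ i (_, s)))).
  apply/(to_homogP (gH i)); rewrite mulg1; exact: subgroupV.
have phi_rel i s : rel (c i (set_val s)) (phi i s).
  have := fr (q (existT _ i (to_homog (H i) 1%g, s))); rewrite -/(phi i s) -jE.
  by have /= <- := congr1 (fun F => F (existT _ i (to_homog (H i) 1%g, s))) square.
have /choice[e eP] i := ext (gH i) (cc i) (cphi i) (c_fix i) (phi_fix i) (phi_rel i).
pose u (p : disk_cells R n H) : E :=
  act (homog_repr (projT2 p).1) (e (projT1 p) (projT2 p).2).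
have uE i x t : u (cell_point H i x t) = act x (e i t).
  rewrite /u /=; have [h Hh ->] := homog_repr_to (gH i) x.
  by rewrite actM; case: (eP i) => _ /(_ t h Hh) ->.
have cu : continuous u.
  apply: disk_cells_continuous => i C; case: (eP i) => ce _ _ _.
  exact: (continuous_compT ce (@act_continuous _ E (homog_repr C))).
have uf : u \o (@cell_boundary R G n I H) = f \o q.
  apply/funext => -[i [C s]] /=; rewrite -(homog_reprK C).
  rewrite -[LHS]/(u (cell_point H i _ (set_val s))) uE qE fa.
  by case: (eP i) => _ _ -> _.
have [w [cw wQ wj]] := pushout_map push cu cf uf.
have wQE i x t : w (Q (cell_point H i x t)) = act x (e i t).
  by rewrite -uE -wQ.
exists w; split; last first.
  move=> x y xy; have -> : y = j x by apply/val_inj; rewrite -!set_valE jE.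
  by rewrite -[RHS]/(f x) -wj.
have cases (y : @skel R G X n.+1) :
    (exists i x t, Q (cell_point H i x t) = y) \/ exists x, j x = y.
  have [[[i [C t]] <-]|] := pushout_cover push y; last by right.
  by left; exists i, (homog_repr C), t; rewrite /cell_point homog_reprK.
split=> // [g y|y].
  have [[i [x [t <-]]]|[x <-]] := cases y.
    have -> : skel_sub g (Q (cell_point H i x t)) = Q (cell_point H i (g * x)%g t).
      by apply/val_inj; rewrite -[LHS]/(act g (set_val _)) -[RHS]/(set_val _) QE.
    by rewrite !wQE actM.
  have -> : skel_sub g (j x) = j (skel_sub g x).
    by apply/val_inj; rewrite -[LHS]/(act g (set_val _)) -[RHS]/(set_val _) !jE.
  by rewrite -![w (j _)]/((w \o j) _) wj fa.
have [[i [x [t <-]]]|[x <-]] := cases y.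
  by rewrite wQE QcE; apply: rel_act; case: (eP i).
by rewrite -[w (j _)]/((w \o j) _) wj jE.
Qed.

(** The partial maps are chosen by recursion on the skeleton, each extending the
    previous one; their union is continuous for the colimit topology. *)
Theorem gmap_extension : exists F : X -> E, gmap F /\ forall x, rel x (F x).
Proof.
pose S n := {f : @skel R G X n -> E | partial_gmap rel f}.
have base : exists f : @skel R G X 0%N -> E, partial_gmap rel f.
  have no (x : @skel R G X 0%N) : False.
    have no0 y : ~ @skel R G X 0%N y by rewrite skel0.
    exact: no0 (set_valP x).
  by exists (fun x => False_rect _ (no x)); split=> [x|g x|x]; case: (no x).
have step n (f : S n) : {f' : S n.+1 | forall x y, set_val x = set_val y ->
    projT1 f' y = projT1 f x}.
  have /cid[f' [f'P ff']] := partial_gmap_extend (projT2 f).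
  by exists (exist _ f' f'P).
pose fs := fix fs n : S n := match n with
  | 0%N => exist _ _ (projT2 (cid base)) | m.+1 => projT1 (step m (fs m)) end.
have fsS n x y : set_val x = set_val y -> projT1 (fs n.+1) y = projT1 (fs n) x.
  by move=> xy; rewrite /=; case: (step n (fs n)) => f' /= /(_ _ _ xy).
have fs_add m k x y : set_val x = set_val y -> projT1 (fs (k + m)%N) y = projT1 (fs m) x.
  elim: k y => [|k IH] y xy.
    by congr (projT1 _ _); apply/val_inj.
  have ky : skel (k + m)%N (set_val y).
    by rewrite -xy; apply: skel_le (set_valP x); rewrite leq_addl.
  pose z : @skel R G X (k + m)%N := SigSub (mem_set ky).
  by rewrite -(IH z xy); exact: (fsS (k + m)%N z y erefl).
have fs_le m n x y : (m <= n)%N -> set_val x = set_val y ->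
    projT1 (fs n) y = projT1 (fs m) x.
  by move=> mn; move: y; rewrite -(subnK mn) => y; exact: fs_add.
have cover (x : X) : exists n, skel n x.
  by have : [set: X] x by []; rewrite -(skel_cover X) => -[n _ nx]; exists n.
pose sub n x (nx : skel n x) : @skel R G X n := SigSub (mem_set nx).
pose F x := projT1 (fs (projT1 (cid (cover x)))) (sub _ x (projT2 (cid (cover x)))).
have FE n (x : @skel R G X n) : F (set_val x) = projT1 (fs n) x.
  rewrite /F; case: cid => m mx /=.
  have [mn|/ltnW nm] := leqP m n; first exact/esym/fs_le.
  exact: fs_le.
have FP x : exists n (y : @skel R G X n), x = set_val y /\ F x = projT1 (fs n) y.
  by have [n nx] := cover x; exists n, (sub n x nx); rewrite -FE.
exists F; split; last first.
  by move=> x; have [n [y [-> ->]]] := FP x; case: (projT2 (fs n)).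
split=> [|g x].
  apply/continuousP => U oU; apply: (@skel_colim R G X) => n.
  have [cfn _ _] := projT2 (fs n).
  have -> : set_val @^-1` (F @^-1` U) = projT1 (fs n) @^-1` U.
    by apply/seteqP; split=> y /=; rewrite FE.
  by move/continuousP: cfn; apply.
have [n [y [-> ->]]] := FP x; case: (projT2 (fs n)) => _ <- _.
exact: (FE n (skel_sub g y)).
Qed.

End Attach.

(** * Uniqueness of classifying spaces *)

Section PathSpace.
Context {R : realType} {G : groupType} (Y : gspace G).

(** A homotopy of maps from a complex is a map from the complex to this space of
    paths with the compact-open topology. Thus pushouts of products with the
    interval, which the structure of a complex does not provide, are avoided.
    Paths are continued by constants, so that they are defined at all times. *)
Definition path_set : set (@compact_open R Y) :=
  [set p | continuous (p : R -> Y) /\ forall t, p (clamp t) = p t].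

Definition path_of (p : path_set) : R -> Y := set_val p.

Lemma path_of_continuous p : continuous (path_of p).
Proof. exact: (proj1 (set_valP p)). Qed.

Lemma path_of_clamp p t : path_of p (clamp t) = path_of p t.
Proof. exact: (proj2 (set_valP p)). Qed.

Lemma path_ext p q : path_of p = path_of q -> p = q.
Proof. by move=> pq; apply/val_inj. Qed.

Lemma path_act_subproof g (p : path_set) :
  path_set (act g \o path_of p : R -> Y).
Proof.
split; last by move=> t /=; rewrite path_of_clamp.
exact: (continuous_compT (@path_of_continuous p) (@act_continuous _ Y g)).
Qed.

Definition path_act g (p : path_set) : path_set := SigSub (mem_set (path_act_subproof g p)).

Lemma path_actE g p t : path_of (path_act g p) t = act g (path_of p t).
Proof. by []. Qed.

Lemma path_act_continuous g : continuous (path_act g).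
Proof.
apply: continuous_set_type.
have cg : continuous (fun p : @compact_open R Y => (act g \o p : @compact_open R Y)).
  move=> p; apply/compact_open_cvgP => [|K U cK oU pKU].
    by apply: fmap_filter; exact: nbhs_filter.
  have oU' : open (act g @^-1` U) by move/continuousP: (@act_continuous _ Y g); apply.
  apply: filterS (open_nbhs_nbhs (conj (compact_open_open cK oU') _)).
    by move=> q /= qKU _ [t Kt <-]; apply: qKU; exists t.
  by move=> _ [t Kt <-]; apply: pKU; exists t.
exact: (continuous_compT (@set_val_continuous _ _) cg).
Qed.

Definition path_space : gspace G.
Proof.
apply: (@Gspace G path_set path_act) path_act_continuous.
- by move=> p; apply: path_ext; apply/funext => t; rewrite path_actE act1.
- by move=> g h p; apply: path_ext; apply/funext => t; rewrite !path_actE actM.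
Defined.

Lemma path_uncurry_continuous {Z : topologicalType} (F : Z -> path_set) :
  continuous F -> continuous (fun z : Z * R => path_of (F z.1) z.2).
Proof.
move=> cF; have cF' : continuous (set_val \o F : Z -> @compact_open R Y).
  exact: (continuous_compT cF (@set_val_continuous _ _)).
have -> : (fun z : Z * R => path_of (F z.1) z.2) = uncurry (fun z => path_of (F z)).
  by apply/funext => -[].
apply: (@continuous_uncurry Z R Y (fun z => path_of (F z))) => //.
- exact: locally_compactR.
- by move=> z; exact: path_of_continuous.
Qed.

End PathSpace.

Section Maps.
Context {R : realType} {G : groupType} (X : gcw R G) (Y : gspace G).

(** The groups [H] of interest are the stabilizers of the cells of [X]. *)
Hypothesis contr : forall H, is_subgroup H -> fixed_points X H !=set0 ->
  contractible R (fixed_points Y H).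

Lemma gmap_exists : exists f : X -> Y, gmap f.
Proof.
pose rel (x : X) (y : Y) := True.
have ext : extendable rel.
  move=> n H c f gH cc cf c_fix f_fix _.
  have YH : contractible R (fixed_points Y H).
    by apply: contr => //; exists (c (disk0 n)).
  pose f' s : fixed_points Y H := SigSub (mem_set (f_fix s)).
  have cf' : continuous f' by apply: continuous_set_type.
  have [e [ce es]] := disk_extension YH cf'.
  exists (fun t => set_val (e t)); split=> // [||s].
  - exact: (continuous_compT ce (@set_val_continuous _ _)).
  - by move=> t; exact: set_valP.
  - by rewrite es.
by have [|f [gf _]] := gmap_extension _ ext; last by exists f.
Qed.

(** A map to the path space is built whose values join [f x] to [g x]. *)
Lemma gmap_homotopic (f g : X -> Y) : gmap f -> gmap g -> ghomotopic R f g.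
Proof.
move=> [cf fa] [cg ga].
pose E := @path_space R G Y.
pose rel (x : X) (p : E) := path_of p 0 = f x /\ path_of p 1 = g x.
have rel_act a x p : rel x p -> rel (act a x) (act a p).
  by case=> p0 p1; rewrite /rel !path_actE p0 p1 fa ga.
have ext : extendable rel.
  move=> n H c phi gH cc cphi c_fix phi_fix phi_rel.
  have YH : contractible R (fixed_points Y H).
    by apply: contr => //; exists (c (disk0 n)).
  have fix_f k (k_gmap : gmap k) t : fixed_points Y H (k (c t)).
    by move=> h Hh; rewrite -(proj2 k_gmap) c_fix.
  have fix_phi s t : fixed_points Y H (path_of (phi s) t).
    by move=> h Hh; rewrite -path_actE -[path_act h _]/(act h (phi s)) phi_fix.
  pose f0 t : fixed_points Y H := SigSub (mem_set (fix_f f (conj cf fa) t)).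
  pose f1 t : fixed_points Y H := SigSub (mem_set (fix_f g (conj cg ga) t)).
  pose F (z : @sphere R n * R) : fixed_points Y H := SigSub (mem_set (fix_phi z.1 z.2)).
  have cf0 : continuous f0.
    by apply: continuous_set_type; exact: (continuous_compT cc cf).
  have cf1 : continuous f1.
    by apply: continuous_set_type; exact: (continuous_compT cc cg).
  have cF : continuous F.
    by apply: continuous_set_type; exact: path_uncurry_continuous.
  have F0 s : F (s, 0) = f0 (set_val s).
    by apply/val_inj; case: (phi_rel s).
  have F1 s : F (s, 1) = f1 (set_val s).
    by apply/val_inj; case: (phi_rel s).
  have [e [ce e0 e1 eF]] := cylinder_extension YH cF cf0 cf1 F0 F1.
  pose e' (z : @disk R n * R) : Y := set_val (e (z.1, clamp z.2)).
  have ce' : continuous e'.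
    apply: (continuous_compT _ (@set_val_continuous _ _)).
    apply: (continuous_compT _ ce); apply: continuous_pair.
      exact: fst_continuous.
    exact: (continuous_compT snd_continuous clamp_continuous).
  have [cce' cpe'] := continuous_curry ce'.
  have pe' t : @path_set R G Y (curry e' t : @compact_open R Y).
    by split=> [|s]; [exact: cpe'|rewrite /curry /e' /= clampK].
  exists (fun t => SigSub (mem_set (pe' t)) : @path_set R G Y); split.
  - by apply: continuous_set_type.
  - move=> t h Hh; apply: path_ext; apply/funext => s.
    exact: (set_valP (e (t, clamp s)) h Hh).
  - move=> s; apply: path_ext; apply/funext => t.
    rewrite -path_of_clamp -[LHS]/(set_val (e (set_val s, clamp (clamp t)))) clampK.
    by rewrite eF ?clamp_itv // -path_of_clamp.
  - by move=> t; split; rewrite -[LHS]/(set_val (e (t, clamp _))) ?clamp0 ?clamp1 ?e0 ?e1.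
have [F [[cF Fa] FP]] := gmap_extension rel_act ext.
have cF2 := path_uncurry_continuous cF.
exists (fun z => path_of (F z.1) z.2); last first.
  by move=> a x t _ /=; rewrite Fa.
by split=> [|x|x]; [exact: continuous_subspaceT|case: (FP x)..].
Qed.

End Maps.

(** Two models of the same classifying space are equivalent: there are maps in
    both directions, and any two parallel maps are homotopic. *)
Theorem classifying_space_unique {R : realType} {G : groupType} (F : set (set G))
    (X Y : gcw R G) : classifying_space F X -> classifying_space F Y ->
  ghomotopy_equivalent R X Y.
Proof.
have contr (A B : gcw R G) : classifying_space F A -> classifying_space F B ->
    forall H, is_subgroup H -> fixed_points A H !=set0 ->
    contractible R (fixed_points B H).
  move=> FA FB H gH AH; have [BH _] := FB H gH; apply: BH.
  by apply: contrapT => /(proj2 (FA H gH)) A0; case: AH => x; rewrite A0.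
have idg (A : gcw R G) : gmap (@idfun A) by split=> //; exact: id_continuous.
move=> FX FY.
have [f gf] := gmap_exists (contr X Y FX FY).
have [k gk] := gmap_exists (contr Y X FY FX).
have comp (A B C : gcw R G) (u : A -> B) (v : B -> C) : gmap u -> gmap v -> gmap (v \o u).
  move=> [cu ua] [cv va]; split=> [|g x /=]; first exact: continuous_compT.
  by rewrite ua va.
exists f, k; split=> //.
- exact: (gmap_homotopic (contr X X FX FX) (comp _ _ _ _ _ gf gk) (idg X)).
- exact: (gmap_homotopic (contr Y Y FY FY) (comp _ _ _ _ _ gk gf) (idg Y)).
Qed.

(** * One-dimensional complexes as graphs *)

Section Interval.
Context {R : realType}.

Definition interval_point (t : R) : @disk R 1 := disk_ret (const_mx t).

Lemma enorm1 (x : 'rV[R]_1) : enorm x = `|x ord0 ord0|.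
Proof. by rewrite /enorm big_ord1 sqrtr_sqr. Qed.

Lemma interval_pointE t : -1 <= t <= 1 -> set_val (interval_point t) = const_mx t.
Proof.
move=> t1; rewrite /interval_point disk_retE enorm1 mxE max_l ?invr1 ?scale1r //.
by rewrite ler_norml.
Qed.

Lemma interval_point_continuous : continuous interval_point.
Proof.
have c : continuous (fun t : R => const_mx t : 'rV[R]_1).
  apply: mx_continuous => i j; under [X in continuous X]eq_fun do rewrite mxE.
  exact: id_continuous.
exact: (continuous_compT c (@disk_ret_continuous R 1)).
Qed.

Definition interval_coord (x : @disk R 1) : R := set_val x ord0 ord0.

Lemma interval_coord_continuous : continuous interval_coord.
Proof.
exact: (continuous_compT (@set_val_continuous _ _) (@coord_continuous _ _ _ ord0 ord0)).
Qed.

Lemma interval_coord_itv x : -1 <= interval_coord x <= 1.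
Proof.
by have := dnorm_le1 x; rewrite enorm1 ler_norml.
Qed.

Lemma interval_coordK x : interval_point (interval_coord x) = x.
Proof.
apply/val_inj; rewrite -[LHS]/(set_val _) interval_pointE ?interval_coord_itv //.
by apply/matrixP => i j; rewrite mxE !ord1.
Qed.

Lemma interval_pointK t : -1 <= t <= 1 -> interval_coord (interval_point t) = t.
Proof. by move=> t1; rewrite /interval_coord interval_pointE // mxE. Qed.

Lemma sphere1_coord (s : @sphere R 1) :
  interval_coord (set_val s) = -1 \/ interval_coord (set_val s) = 1.
Proof.
have /sphere_enorm : @sphere R 1 (set_val s) by exact: set_valP.
rewrite enorm1 -/(interval_coord _) => s1.
by case: (ger0P (interval_coord (set_val s))) s1 => _ <-; rewrite ?opprK; auto.
Qed.

Lemma interval_end_subproof (t : R) : `|t| = 1 -> @sphere R 1 (interval_point t).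
Proof.
move=> t1; apply/sphere_enorm; rewrite enorm1 interval_pointE ?mxE //.
by rewrite -ler_norml t1.
Qed.

Definition interval_end (t : R) (t1 : `|t| = 1) : @sphere R 1 :=
  SigSub (mem_set (interval_end_subproof t1)).

End Interval.

(** A graph with an action, presented by characteristic maps of its edges. The
    map [cell_of] records that distinct open edges are disjoint, and [graph_map]
    is the universal property of the topology. *)
Record graph (R : realType) (G : groupType) (Z : gspace G) := Graph {
  vert : set Z;
  edge : choiceType;
  chr : edge -> R -> Z;
  chr_continuous : forall e, continuous (chr e);
  chr_end : forall e, vert (chr e (-1)) /\ vert (chr e 1);
  graph_cover : forall z, vert z \/ exists e t, -1 < t < 1 /\ chr e t = z;
  cell_of : Z -> option edge;
  cell_chr : forall e t, -1 < t < 1 -> cell_of (chr e t) = Some e;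
  graph_map : forall (Y : topologicalType) (f : Z -> Y) (g : edge -> R -> Y),
    (forall e, continuous (g e)) ->
    (forall e, g e (-1) = f (chr e (-1)) /\ g e 1 = f (chr e 1)) ->
    exists w : Z -> Y, [/\ continuous w, forall z, vert z -> w z = f z &
      forall e t, -1 <= t <= 1 -> w (chr e t) = g e t];
  vert_act : forall g z, vert z -> vert (act g z);
  edge_act : G -> edge -> edge;
  chr_act : forall g e t, chr (edge_act g e) t = act g (chr e t) }.

Section GraphOfComplex.
Context {R : realType} {G : groupType} (X : gcw R G).

(** The 0-skeleton is the set of 0-cells, with no attaching maps, so any map from
    it is continuous. *)
Lemma skel1_discrete (Y : topologicalType) (f : @skel R G X 1 -> Y) : continuous f.
Proof.
have [I [H [q [Q [j [_ _ _ push]]]]]] := skelS X 0%N.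
have [[_ _ cQ _] [square _]] := push.
have cu : continuous (f \o Q).
  apply: disk_cells_continuous => i C.
  have -> : (fun t => (f \o Q) (existT _ i (C, t))) =
            fun=> (f \o Q) (existT _ i (C, disk0 0)).
    apply/funext => t; congr ((f \o Q) (existT _ i (C, _))).
    by apply/val_inj/matrixP => ? [].
  exact: cst_continuous.
have cv : continuous (f \o j).
  move=> x; have no y : ~ @skel R G X 0%N y by rewrite skel0.
  by case: (no _ (set_valP x)).
have sq : (f \o Q) \o (@cell_boundary R G 0 I H) = (f \o j) \o q.
  by rewrite -compA square compA.
have [w [cw wQ wj]] := pushout_map push cu cv sq.
have -> : f = w.
  apply/funext => x; have [[y <-]|[z <-]] := pushout_cover push x.
    by have := congr1 (fun F => F y) wQ.
  by have := congr1 (fun F => F z) wj.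
exact: cw.
Qed.

(** The edges are the pairs of a 1-cell and a coset of its stabilizer. The
    classifying map [cell_of] comes from the universal property on the level of
    sets, the open edges being sent to their names and the vertices to [None]. *)
Lemma graph_of_complex : @skel R G X 2 = setT -> exists _ : graph R X, True.
Proof.
move=> dim1; have [I [H [q [Q [j [gH QE jE push]]]]]] := skelS X 1%N.
have [[_ _ cQ _] [square _]] := push.
have in2 x : @skel R G X 2 x by rewrite dim1.
pose sub2 x : @skel R G X 2 := SigSub (mem_set (in2 x)).
have csub2 : continuous sub2 by apply: continuous_set_type; exact: id_continuous.
pose E := {i : I & homog (H i)}.
pose chi (e : E) (t : R) : X :=
  set_val (Q (existT _ (projT1 e) (projT2 e, interval_point t))).
have cchi e : continuous (chi e).
  have cp := continuous_compT interval_point_continuous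
    (@disk_cell_continuous R G 1 I H (projT1 e) (projT2 e)).
  exact: (continuous_compT (continuous_compT cp cQ) (@set_val_continuous _ _)).
have chi_end e t (t1 : `|t| = 1) :
    chi e t = set_val (q (existT _ (projT1 e) (projT2 e, interval_end t1))).
  rewrite -jE.
  by have /= <- := congr1 (fun F => F (existT _ (projT1 e) (projT2 e, interval_end t1))) square.
have n1 : `|(-1) : R| = 1 by rewrite normrN1.
have p1 : `|1 : R| = 1 by rewrite normr1.
have end_vert e t : `|t| = 1 -> skel 1 (chi e t).
  by move=> t1; rewrite (chi_end e t t1); exact: set_valP.
have cover z : skel 1 z \/ exists e t, -1 < t < 1 /\ chi e t = z.
  have [[[i [C x]] Qx]|[y jy]] := pushout_cover push (sub2 z); last first.
    by left; have : @skel R G X 1 (set_val y) := set_valP y; rewrite -jE jy.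
  pose e : E := existT _ i C; pose t := interval_coord x.
  have zE : chi e t = z by rewrite /chi interval_coordK Qx.
  have := interval_coord_itv x; rewrite -/t => /andP[t1 t2].
  have [tn|tn] := eqVneq `|t| 1; first by left; rewrite -zE; exact: end_vert.
  right; exists e, t; split=> //; rewrite -ltr_norml lt_neqAle tn /=.
  by rewrite ler_norml t1.
pose cu (p : disk_cells R 1 H) : option E :=
  if `|interval_coord (projT2 p).2| < 1 then Some (existT _ (projT1 p) (projT2 p).1) else None.
have cuq : cu \o (@cell_boundary R G 1 I H) = (fun=> None) \o q.
  apply/funext => -[i [C s]] /=; rewrite /cu /=.
  by case: (sphere1_coord s) => ->; rewrite ?normrN1 ?normr1 ltxx.
have [cell [cellQ _]] := pushout_set_map push cuq.
pose eact g (e : E) : E :=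
  existT _ (projT1 e) (to_homog (H (projT1 e)) (g * homog_repr (projT2 e))%g).
unshelve eexists (@Graph R G X (@skel R G X 1) E chi cchi _ cover (cell \o sub2) _ _ _ eact _) => //.
- by move=> e; split; exact: end_vert.
- move=> e t t1; have te : -1 <= t <= 1 by case/andP: t1 => ? ?; rewrite !ltW.
  have -> : (cell \o sub2) (chi e t) =
      (cell \o Q) (existT _ (projT1 e) (projT2 e, interval_point t)).
    by congr (cell _); apply/val_inj.
  by rewrite cellQ /cu /= interval_pointK // ltr_norml t1; case: e.
- move=> Y f g cg gf.
  pose u (p : disk_cells R 1 H) : Y :=
    g (existT _ (projT1 p) (projT2 p).1) (interval_coord (projT2 p).2).
  have c_u : continuous u.
    apply: disk_cells_continuous => i C.
    exact: (continuous_compT interval_coord_continuous (cg (existT _ i C))).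
  have uf : u \o (@cell_boundary R G 1 I H) = (f \o set_val) \o q.
    apply/funext => -[i [C s]]; rewrite /u /=; pose e : E := existT _ i C.
    have [s1|s1] := sphere1_coord s; rewrite s1; have [g0 g1] := gf e.
      rewrite -/e g0 (chi_end e (-1) n1); congr (f (set_val (q (existT _ i (C, _))))).
      by apply/val_inj; rewrite /= -[RHS]interval_coordK s1.
    rewrite -/e g1 (chi_end e 1 p1); congr (f (set_val (q (existT _ i (C, _))))).
    by apply/val_inj; rewrite /= -[RHS]interval_coordK s1.
  have [w [cw wQ wj]] := pushout_map push c_u (@skel1_discrete Y (f \o set_val)) uf.
  exists (w \o sub2); split=> [|z z1|e t t1].
  + exact: continuous_compT.
  + pose z' : @skel R G X 1 := SigSub (mem_set z1).
    have -> : (w \o sub2) z = (w \o j) z'.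
      by congr (w _); apply/val_inj; rewrite -[RHS]/(set_val _) jE.
    by rewrite wj.
  + have -> : (w \o sub2) (chi e t) =
        (w \o Q) (existT _ (projT1 e) (projT2 e, interval_point t)).
      by congr (w _); apply/val_inj.
    by rewrite wQ /u /= interval_pointK //; case: e.
- by move=> g z; exact: skel_act.
- move=> g [i C] t; rewrite /chi /eact /=.
  rewrite -{2}(homog_reprK C); exact: (QE g i (homog_repr C) (interval_point t)).
Qed.

End GraphOfComplex.

(** * Contractible graphs are trees *)

(** Intermediate value theorem, in the form in which it shows that a continuous
    function without zeros keeps its sign. *)
Lemma no_sign_change {R : realType} (f : R -> R) (a b : R) : a <= b ->
  continuous f -> (forall t, a <= t <= b -> f t != 0) -> 0 < f a * f b.
Proof.
move=> ab cf f0; rewrite lt_neqAle eq_sym mulf_neq0 ?f0 ?lexx ?ab //=.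
rewrite leNgt; apply/negP => neg.
have [|c] := @IVT R f a b 0 ab (continuous_subspaceT cf).
  by rewrite ge_min le_max; move: neg; rewrite !leNgt;
    case: (ltrP (f a) 0) => fa; case: (ltrP (f b) 0) => fb //=; nra.
by rewrite in_itv /= => cab fc; move: (f0 c cab); rewrite fc eqxx.
Qed.

(** A Lebesgue number argument: the set of the pairs [(t, s)] is compact. *)
Lemma uniformly_positive {R : realType} (g : R * R * R -> R) :
  continuous g -> (forall t s, 0 < g (t, s, s)) ->
  \forall n \near \oo, forall t s s', -1 <= t <= 1 -> 0 <= s <= 1 ->
    `|s - s'| <= n.+1%:R^-1 -> 0 < g (t, s, s').
Proof.
move=> cg g0.
have cK : compact (`[-1, 1] `*` `[0, 1] : set (R * R)).
  by apply: compact_setX; exact: segment_compact.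
pose P (n : nat) (x : R * R) := forall s', `|x.2 - s'| <= n.+1%:R^-1 -> 0 < g (x, s').
have : \forall n \near \oo, `[-1, 1] `*` `[0, 1] `<=` P n.
  apply: ((compact_near_coveringP _).1 cK) => -[t s] _.
  have : \forall y \near (t, s, s), 0 < g y.
    exact: (cvgr_gt _ (cg (t, s, s)) _ (g0 t s)).
  case=> -[U W] /= [tsU sW] UW.
  have [e /= e0 eW] := (nbhs_ballP _ _).1 sW.
  have e20 : 0 < e / 2 by rewrite divr_gt0.
  have U2 : nbhs (t, s) (U `&` [set x | `|s - x.2| < e / 2]).
    apply: filterI => //; exists (setT, ball s (e / 2)) => /=.
      by split; [exact: filterT|exact: nbhsx_ballx].
    by move=> [a b] [].
  have near_n : \forall n \near \oo, n.+1%:R^-1 < e / 2.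
    have := @near_infty_natSinv_lt R (PosNum e20); exact.
  exists (U `&` [set x | `|s - x.2| < e / 2], [set n | n.+1%:R^-1 < e / 2 :> R]) => //=.
  move=> [x n] /= [[Ux sx] nn] s' xs'; apply: (UW (x, s')); split=> //=.
  apply: eW; rewrite -ball_normE /= (splitr e).
  apply: (le_lt_trans (ler_distD x.2 s s')); apply: ltrD => //.
  exact: le_lt_trans xs' nn.
apply: filterS => n nP t s s' t1 s1 ss'; exact: (nP (t, s)).
Qed.

Section TreeOfGraph.
Context {R : realType} {G : groupType} {Z : gspace G} (Gr : graph R Z).
Hypothesis contr : contractible R Z.

Local Notation V := (vert Gr).
Local Notation E := (edge Gr).

Definition joined (P : set E) (u v : V) : Prop := exists2 e, P e &
  (set_val u = chr e (-1) /\ set_val v = chr e 1) \/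
  (set_val v = chr e (-1) /\ set_val u = chr e 1).

Lemma joined_sym P u v : joined P u v -> joined P v u.
Proof. by case=> e Pe ee; exists e => //; case: ee; [right|left]. Qed.

Definition vert_of z (h : V z) : V := SigSub (mem_set h).

(** The function with value [1] on the combinatorial component of [u], edges
    included, and [-1] elsewhere is continuous; it has no sign change along the
    paths that contract [u] and [v] to the same point. *)
Lemma joined_connected u v : exists n, walk (joined setT) n u v.
Proof.
have [x0 [N [cN N0 N1]]] := contractibleP contr.
pose reach z := exists2 v : V, set_val v = z & exists n, walk (joined setT) n u v.
pose f z : R := if `[< reach z >] then 1 else -1.
have reach_step (e : E) (a b : R) : (a = -1 /\ b = 1) \/ (a = 1 /\ b = -1) ->
    reach (chr e a) -> reach (chr e b).
  move=> ab [x xe [n ux]]; have [ve1 ve2] := @chr_end _ _ _ Gr e.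
  case: ab => -[aE bE]; subst a b.
    exists (vert_of ve2) => //; exists n.+1; apply: walk_rcons ux _.
    by exists e => //; left.
  exists (vert_of ve1) => //; exists n.+1; apply: walk_rcons ux _.
  by exists e => //; right.
have fE (e : E) : f (chr e (-1)) = f (chr e 1).
  by rewrite /f; congr (if _ then _ else _); apply: asbool_equiv_eq; split;
    apply: reach_step; [left|right].
have [||w [cw wV wE]] := @graph_map _ _ _ Gr R f (fun e _ => f (chr e (-1))).
- by move=> e; exact: cst_continuous.
- by move=> e; rewrite fE.
have w0 z : w z != 0.
  have f0 y : f y != 0 by rewrite /f; case: ifP => _; rewrite ?oppr_eq0 oner_eq0.
  have [Vz|[e [t [/andP[t1 t2] <-]]]] := graph_cover Gr z; first by rewrite wV.
  by rewrite wE // !ltW.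
have wx0 z : 0 < w z * w x0.
  have cz : continuous (fun t => w (N (z, t))).
    apply: (continuous_compT _ cw); apply: (continuous_compT _ cN).
    by apply: continuous_pair; [exact: cst_continuous|exact: id_continuous].
  by rewrite -{1}(N0 z) -(N1 z 1 (lexx _)); exact: (no_sign_change ler01 cz).
have wu : w (set_val u) = 1.
  rewrite wV; last exact: set_valP.
  by rewrite /f asboolT //; exists u => //; exists 0%N.
have wv : 0 < w (set_val v).
  by have := wx0 (set_val u); rewrite wu mul1r => x0p; have := wx0 (set_val v);
    rewrite pmulr_lgt0.
move: wv; rewrite wV; last exact: set_valP.
rewrite /f; case: asboolP => [[v' vv' [n uv']] _|_]; last by rewrite ltr0N1.
by exists n; have <- : v' = v by apply/val_inj.
Qed.

Section Wall.
Variable e0 : E.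

(** A map to rank one symmetric matrices that makes a half turn along the edge
    and is constant elsewhere: its values are [u u^T], where [u] is
    [(t, 1 - t^2)] on the edge and [(1, 0)] elsewhere. In other words, this is
    a real line bundle on the graph; it is trivial as the graph is contractible,
    and a trivialization changes signs along the edge only. *)
Lemma line_bundle : exists (p q r : Z -> R) (U : Z -> R * R),
  [/\ continuous p, continuous q, continuous r &
      [/\ forall z, [/\ p z = (U z).1 ^+ 2, q z = (U z).1 * (U z).2,
                        r z = (U z).2 ^+ 2 & 0 < (U z).1 ^+ 2 + (U z).2 ^+ 2],
          forall e t, e != e0 -> -1 <= t <= 1 -> p (chr e t) = 1 &
          forall t, -1 <= t <= 1 -> [/\ p (chr e0 t) = t ^+ 2,
            q (chr e0 t) = t * (1 - t ^+ 2) & r (chr e0 t) = (1 - t ^+ 2) ^+ 2]]].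
Proof.
have ct2 : continuous (fun t : R => t ^+ 2).
  by apply: (@mulR_continuous _ _ id id); exact: id_continuous.
have ct2' : continuous (fun t : R => 1 - t ^+ 2).
  apply: addR_continuous; first exact: cst_continuous.
  exact: oppR_continuous.
have mk (a : R) (g : R -> R) : continuous g -> g (-1) = a -> g 1 = a ->
    exists w : Z -> R, [/\ continuous w, forall z, V z -> w z = a &
      forall e t, -1 <= t <= 1 -> w (chr e t) = if e == e0 then g t else a].
  move=> cg gm gp.
  apply: (@graph_map _ _ _ Gr R (fun=> a) (fun e t => if e == e0 then g t else a)).
    by move=> e; case: eqP => _; [exact: cg|exact: cst_continuous].
  by move=> e; case: eqP.
have [||p [cp pV pE]] := mk 1 (fun t => t ^+ 2) ct2; [by rewrite sqrrN expr1n|exact: expr1n|].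
have [|||q [cq qV qE]] := mk 0 (fun t => t * (1 - t ^+ 2)).
- by apply: mulR_continuous => //; exact: id_continuous.
- by rewrite sqrrN expr1n subrr mulr0.
- by rewrite expr1n subrr mulr0.
have [|||r [cr rV rE]] := mk 0 (fun t => (1 - t ^+ 2) ^+ 2).
- exact: (continuous_compT ct2' ct2).
- by rewrite sqrrN expr1n subrr expr0n.
- by rewrite expr1n subrr expr0n.
have /choice[U UP] z : exists u : R * R, [/\ p z = u.1 ^+ 2, q z = u.1 * u.2,
    r z = u.2 ^+ 2 & 0 < u.1 ^+ 2 + u.2 ^+ 2].
  have [Vz|[e [t [/andP[t1 t2] <-]]]] := graph_cover Gr z.
    by exists (1, 0); rewrite pV // qV // rV //= expr1n mulr0 expr0n addr0.
  have te : -1 <= t <= 1 by rewrite !ltW.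
  rewrite pE // qE // rE //; case: eqP => _; last first.
    by exists (1, 0); rewrite /= expr1n mulr0 expr0n addr0.
  exists (t, 1 - t ^+ 2); split=> //=.
  have [->|t0] := eqVneq t 0; first by rewrite expr0n subr0 expr1n add0r.
  by apply: ltr_pwDl; rewrite ?sqr_ge0 // exprn_even_gt0.
exists p, q, r, U; split=> //; split=> //.
- by move=> e t ne t1; rewrite pE // (negbTE ne).
- by move=> t t1; rewrite pE // qE // rE // eqxx.
Qed.

(** Transport along the contraction, sampled finely enough, gives the
    trivialization along any finite number of edges. *)
Lemma transport_sign : exists F : nat -> Z -> R,
  (forall e : E, e != e0 ->
    \forall n \near \oo, 0 < F n (chr e (-1)) * F n (chr e 1)) /\
  (\forall n \near \oo, F n (chr e0 (-1)) * F n (chr e0 1) < 0).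
Proof.
have [x0 [N [cN N0 N1]]] := contractibleP contr.
have [p [q [r [U [cp cq cr [UP pe0 pqr0]]]]]] := line_bundle.
(* At the times [s n k] the contraction is followed backwards, from the constant
   map to the identity, and vectors are projected from each line of the bundle
   to the next one; [S] is the square of the scalar product of their
   generators, so it does not vanish when the two times are close. *)
pose s n k : R := 1 - k%:R / n.+1%:R.
pose F n := fix F k (z : Z) : R * R := if k is k'.+1 then
    let a := F k' z in let y := N (z, s n k) in
    (p y * a.1 + q y * a.2, q y * a.1 + r y * a.2)
  else U x0.
have cNs n k : continuous (fun z => N (z, s n k)).
  by apply: (continuous_compT _ cN); apply: continuous_pair;
    [exact: id_continuous|exact: cst_continuous].
have cF n k : continuous (fun z => (F n k z).1) /\ continuous (fun z => (F n k z).2).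
  elim: k => [|k [c1 c2]]; first by split; exact: cst_continuous.
  have cpN := continuous_compT (cNs n k.+1) cp.
  have cqN := continuous_compT (cNs n k.+1) cq.
  have crN := continuous_compT (cNs n k.+1) cr.
  by split; apply: addR_continuous; apply: mulR_continuous.
pose S z a b := p (N (z, a)) * p (N (z, b)) + 2 * (q (N (z, a)) * q (N (z, b)))
  + r (N (z, a)) * r (N (z, b)).
have SE z a b : S z a b = ((U (N (z, a))).1 * (U (N (z, b))).1 +
                           (U (N (z, a))).2 * (U (N (z, b))).2) ^+ 2.
  rewrite /S; have [-> -> -> _] := UP (N (z, a)); have [-> -> -> _] := UP (N (z, b)).
  by ring.
have Sdiag z a : 0 < S z a a.
  by rewrite SE; have [_ _ _ h] := UP (N (z, a)); rewrite -!expr2 exprn_gt0.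
have F_U n m z : (forall k, (k < m)%N -> 0 < S z (s n k) (s n k.+1)) ->
    exists2 l, l != 0 & F n m z = (l * (U (N (z, s n m))).1, l * (U (N (z, s n m))).2).
  elim: m => [|m IH] Spos.
    exists 1; first exact: oner_neq0.
    by rewrite !mul1r /s mul0r subr0 N1 //= ; case: (U x0).
  have [k km|l l0 FE] := IH; first by apply: Spos; rewrite ltnS ltnW.
  have Sm := Spos m (ltnSn m); rewrite SE in Sm.
  exists (l * ((U (N (z, s n m))).1 * (U (N (z, s n m.+1))).1 +
               (U (N (z, s n m))).2 * (U (N (z, s n m.+1))).2)).
    by rewrite mulf_neq0 //; apply: contraTneq Sm => ->; rewrite expr0n ltxx.
  rewrite /= FE /=; have [-> -> -> _] := UP (N (z, s n m.+1)).
  by congr (_, _); ring.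
have fine (e : E) : \forall n \near \oo, forall t, -1 <= t <= 1 ->
    exists2 l, l != 0 & F n n.+1 (chr e t) = (l * (U (chr e t)).1, l * (U (chr e t)).2).
  pose g (x : R * R * R) := S (chr e x.1.1) x.1.2 x.2.
  have cg : continuous g.
    have cN1 : continuous (fun x : R * R * R => N (chr e x.1.1, x.1.2)).
      apply: (continuous_compT _ cN).
      have c1 := @fst_continuous (R * R)%type R.
      apply: continuous_pair; last exact: (continuous_compT c1 snd_continuous).
      exact: (continuous_compT (continuous_compT c1 fst_continuous)
        (@chr_continuous _ _ _ Gr e)).
    have cN2 : continuous (fun x : R * R * R => N (chr e x.1.1, x.2)).
      apply: (continuous_compT _ cN).
      have c1 := @fst_continuous (R * R)%type R.
      apply: continuous_pair; last exact: snd_continuous.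
      exact: (continuous_compT (continuous_compT c1 fst_continuous)
        (@chr_continuous _ _ _ Gr e)).
    apply: addR_continuous; first apply: addR_continuous.
    - exact: (mulR_continuous (continuous_compT cN1 cp) (continuous_compT cN2 cp)).
    - apply: mulR_continuous; first exact: cst_continuous.
      exact: (mulR_continuous (continuous_compT cN1 cq) (continuous_compT cN2 cq)).
    - exact: (mulR_continuous (continuous_compT cN1 cr) (continuous_compT cN2 cr)).
  have := uniformly_positive cg (fun t a => Sdiag (chr e t) a).
  apply: filterS => n gpos t t1.
  have n0 : 0 < n.+1%:R :> R by rewrite ltr0n.
  have [k kn|l l0 FE] := @F_U n n.+1 (chr e t).
    apply: (gpos t (s n k) (s n k.+1) t1).
      rewrite /s subr_ge0 gerBl ler_pdivrMr // mul1r ler_nat (ltnW kn) /=.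
      by rewrite divr_ge0.
    have -> : s n k - s n k.+1 = n.+1%:R^-1 by rewrite /s -[k.+1%:R]natr1; ring.
    by rewrite ger0_norm // invr_ge0 ltW.
  exists l => //; rewrite FE /s divff ?gt_eqF // subrr.
  by rewrite N0.
exists (fun n z => (F n n.+1 z).1); split=> [e ne|].
  have := fine e; apply: filterS => n FU.
  apply: (@no_sign_change _ (fun t => (F n n.+1 (chr e t)).1)).
  - by rewrite lerN10 ler01 || lra.
  - exact: (continuous_compT (@chr_continuous _ _ _ Gr e) (cF n n.+1).1).
  - move=> t t1; have [l l0 ->] := FU t t1; rewrite mulf_neq0 //=.
    have := pe0 e t ne t1; have [-> _ _ _] := UP (chr e t).
    by apply: contra_eq_neq => ->; rewrite expr0n eq_sym oner_neq0.
have := fine e0; apply: filterS => n FU.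
(* The scalar product with the section [(t, 1 - t^2)] along the edge, which is
   [(-1, 0)] at one end and [(1, 0)] at the other one. *)
pose m t := (F n n.+1 (chr e0 t)).1 * t + (F n n.+1 (chr e0 t)).2 * (1 - t ^+ 2).
have m0 : 0 < m (-1) * m 1.
  apply: no_sign_change.
  - by lra.
  - have c1 := continuous_compT (@chr_continuous _ _ _ Gr e0) (cF n n.+1).1.
    have c2 := continuous_compT (@chr_continuous _ _ _ Gr e0) (cF n n.+1).2.
    apply: addR_continuous; apply: mulR_continuous => //; first exact: id_continuous.
    apply: addR_continuous; first exact: cst_continuous.
    by apply: oppR_continuous; apply: (@mulR_continuous _ _ id id); exact: id_continuous.
  - move=> t t1; have [l l0 FE] := FU t t1; rewrite /m FE /=.
    have -> : l * (U (chr e0 t)).1 * t + l * (U (chr e0 t)).2 * (1 - t ^+ 2) =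
      l * ((U (chr e0 t)).1 * t + (U (chr e0 t)).2 * (1 - t ^+ 2)) by ring.
    rewrite mulf_neq0 //; set h := (X in X != 0).
    have h2 : h ^+ 2 = (t ^+ 2 + (1 - t ^+ 2) ^+ 2) ^+ 2.
      transitivity ((U (chr e0 t)).1 ^+ 2 * t ^+ 2 +
        2 * ((U (chr e0 t)).1 * (U (chr e0 t)).2) * (t * (1 - t ^+ 2)) +
        (U (chr e0 t)).2 ^+ 2 * (1 - t ^+ 2) ^+ 2); first by rewrite /h; ring.
      have [<- <- <- _] := UP (chr e0 t); have [-> -> ->] := pqr0 t t1.
      by ring.
    suff : h ^+ 2 != 0 by apply: contraNneq => ->; rewrite expr0n.
    rewrite h2 expf_eq0 /= gt_eqF //.
    have [->|t0] := eqVneq t 0; first by rewrite expr0n subr0 expr1n add0r.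
    by apply: ltr_pwDl; rewrite ?sqr_ge0 // exprn_even_gt0.
move: m0; rewrite /m sqrrN expr1n subrr !mulr0 !addr0 mulr1 mulrN1 mulNr oppr_gt0.
by [].
Qed.

(** Along a walk that avoids the edge the signs of the trivialization do not
    change, and they do change from one end of the edge to the other. *)
Lemma edge_separates n (u v : V) : walk (joined [set e | e != e0]) n u v ->
  ~ (set_val u = chr e0 (-1) /\ set_val v = chr e0 1).
Proof.
have [F [Foff Fon]] := transport_sign.
move=> uv [u0 v0].
have ev : \forall k \near \oo, (0 < F k (set_val u)) = (0 < F k (set_val v)).
  move: uv {u0 v0}; elim: n u => [u ->|n IH u [w [e ne uw] wv]]; first by near=> n.
  apply: (filterS2 _ _ (IH w wv) (Foff e ne)) => k <- ek.
  have {}ek : 0 < F k (set_val u) * F k (set_val w).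
    by case: uw => -[-> ->] //; rewrite mulrC.
  by apply/idP/idP => h; move: ek; [rewrite pmulr_rgt0|rewrite pmulr_lgt0].
have [k [/= sgn neg]] := filter_ex (filterI ev Fon).
move: sgn neg; rewrite u0 v0; set a := F k _; set b := F k _ => sgn neg.
have [a0|a0] := ltP 0 a; first by move: neg; rewrite pmulr_rlt0 // ltNge ltW // -sgn.
have b0 : b <= 0 by rewrite leNgt -sgn ltNge a0.
by move: neg; rewrite ltNge mulr_le0.
Unshelve. all: by end_near. Qed.

End Wall.

(** The wall of an edge is the set of vertices which can be reached from one of
    its ends by walks that avoid the edge. *)
Theorem contractible_graph_tree : is_tree (joined setT).
Proof.
split; [by move=> u v; exact: joined_sym|exact: joined_connected|].
move=> x y [e0 _ xy]; have [a1 b1] := @chr_end _ _ _ Gr e0.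
pose a := vert_of a1; pose b := vert_of b1.
pose P := joined [set e | e != e0].
pose f (v : V) : bool := `[< exists n, walk P n a v >].
have fa : f a by apply/asboolP; exists 0%N.
have fb : f b = false.
  by apply/asboolP => -[n ab]; exact: (edge_separates ab).
have step u v : P u v -> f u -> f v.
  by move=> uv /asboolP[n au]; apply/asboolP; exists n.+1; apply: walk_rcons au uv.
have ends : forall u v : V, (set_val u = chr e0 (-1) /\ set_val v = chr e0 1) ->
    u = a /\ v = b.
  by move=> u v [ua vb]; split; apply/val_inj.
exists f; split; first by case: xy => /ends[-> ->]; rewrite fa fb.
move=> u v [e _ uv] fuv; have [ee|ne] := eqVneq e e0.
  rewrite ee in uv; case: uv => /ends[-> ->]; case: xy => /ends[-> ->]; auto.
have Puv : P u v by exists e.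
move: fuv; have -> : f u = f v; last by rewrite eqxx.
by apply/idP/idP; apply: step => //; exact: joined_sym.
Qed.

End TreeOfGraph.

(** * Low-dimensional models *)

Section Equivalence.
Context {R : realType} {G : groupType}.

Lemma contractible_fixed1 (X : gspace G) :
  contractible R (fixed_points X [set 1%g]) -> contractible R X.
Proof.
case/contractibleP => x0 [h [ch h0 h1]].
have fix1 x : fixed_points X [set 1%g] x by move=> g ->; exact: act1.
pose i x : fixed_points X [set 1%g] := SigSub (mem_set (fix1 x)).
have ci : continuous i by apply: continuous_set_type; exact: id_continuous.
exists (set_val x0), (fun p => set_val (h (i p.1, p.2))); split=> [|x|x].
- apply: continuous_subspaceT; apply: (continuous_compT _ (@set_val_continuous _ _)).
  apply: (continuous_compT _ ch); apply: continuous_pair; last exact: snd_continuous.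
  exact: (continuous_compT fst_continuous ci).
- by rewrite /= h0.
- by rewrite /= h1.
Qed.

(** The homotopy from the identity to the composite through [X] is followed by
    the image of the contraction of [X]. *)
Lemma contractible_equivalent (Z X : gspace G) :
  ghomotopy_equivalent R Z X -> contractible R X -> contractible R Z.
Proof.
move=> [f [k [[cf _] [ck _] [h [/homotopy_clamp ch h0 h1] _] _]]].
case/contractibleP => x0 [N [cN N0 N1]].
pose A : set (Z * R) := [set p | p.2 <= 1 / 2].
pose B : set (Z * R) := [set p | 1 / 2 <= p.2].
pose H1 (p : Z * R) : Z := h (p.1, clamp (1 - 2 * p.2)).
pose H2 (p : Z * R) : Z := k (N (f p.1, 2 * p.2 - 1)).
have c2 : continuous (fun p : Z * R => 2 * p.2).
  by apply: mulR_continuous; [exact: cst_continuous|exact: snd_continuous].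
have cH1 : continuous H1.
  apply: (@continuous_compT _ _ _ (fun p : Z * R => (p.1, 1 - 2 * p.2)) _ _ ch).
  apply: continuous_pair; first exact: fst_continuous.
  by apply: addR_continuous; [exact: cst_continuous|exact: oppR_continuous].
have cH2 : continuous H2.
  apply: (continuous_compT _ ck); apply: (continuous_compT _ cN).
  apply: continuous_pair; first exact: (continuous_compT fst_continuous cf).
  by apply: addR_continuous => //; exact: cst_continuous.
exists (k x0), (fun p => if p.2 <= 1 / 2 then H1 p else H2 p); split=> [|z|z].
- apply: continuous_subspaceT; apply: (@continuous_glue _ _ A B).
  + by apply: closed_leR; [exact: snd_continuous|exact: cst_continuous].
  + by apply: closed_leR; [exact: cst_continuous|exact: snd_continuous].
  + by move=> p; case: (leP p.2 (1 / 2)) => [|/ltW]; [left|right].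
  + by apply: (continuous_within_eq cH1) => p /= ->.
  + apply: (continuous_within_eq cH2) => -[z t] /= t1; case: ifP => // t2.
    have -> : t = 1 / 2 by apply/eqP; rewrite eq_le t1 t2.
    have e1 : 1 - 2 * (1 / 2) = 0 :> R by lra.
    have e2 : 2 * (1 / 2) - 1 = 0 :> R by lra.
    by rewrite /H1 /H2 /= e1 e2 clamp0 h0 N0.
- by rewrite /= ifT ?(divr_ge0 ler01) // /H1 /= mulr0 subr0 clamp1 h1.
- rewrite /= ifF; last by apply/negbTE; rewrite -ltNge; lra.
  by rewrite /H2 N1 //=; lra.
Qed.

Lemma fixed_points_gmap (Z X : gspace G) (f : Z -> X) (H : set G) : gmap f ->
  fixed_points Z H !=set0 -> fixed_points X H !=set0.
Proof. by move=> [_ fa] [z zH]; exists (f z) => h Hh; rewrite -fa zH. Qed.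

Lemma hdim_le (Z : gcw R G) (X : gspace G) n :
  ghomotopy_equivalent R Z X -> @skel R G Z n.+1 = setT ->
  (hdim R X <= n%:R%:E)%E.
Proof.
move=> ZX Zn; apply: (@le_trans _ _ (gcw_dim Z)).
  by apply: ereal_inf_lbound; exists Z.
by apply: ereal_inf_lbound; exists n.
Qed.

Lemma hdim_lt (X : gspace G) n : (hdim R X < n.+1%:R%:E)%E ->
  exists Z : gcw R G, ghomotopy_equivalent R Z X /\ @skel R G Z n.+1 = setT.
Proof.
move/ereal_inf_lt => [_ [Z ZX ->] /ereal_inf_lt[_ [m Zm <-]]].
rewrite lte_fin ltr_nat => mn; exists Z; split=> //.
by apply/seteqP; split=> // x _; apply: (skel_le mn); rewrite Zm.
Qed.

End Equivalence.

Section Models.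
Context {R : realType} {G : groupType} (F : set (set G)) (F1 : F [set 1%g]).
Context (X Z : gcw R G) (FX : classifying_space F X).
Hypothesis ZX : ghomotopy_equivalent R Z X.

Lemma subgroup_set1 : is_subgroup [set 1%g : G].
Proof. by apply/subgroupP; split=> // _ _ -> ->; rewrite mulgV. Qed.

Lemma model_contractible : contractible R Z.
Proof.
apply: (contractible_equivalent ZX); apply: contractible_fixed1.
exact: (proj1 (FX subgroup_set1)).
Qed.

(** Equivariant maps in both directions show that equivalent spaces have the
    same subgroups with fixed points. *)
Lemma model_fixed H : is_subgroup H -> F H <-> fixed_points Z H !=set0.
Proof.
move=> gH; have [f [k [gf gk _ _]]] := ZX; have [FH nFH] := FX gH; split.
  by move=> /FH[x0 _]; apply: (fixed_points_gmap gk); exists (set_val x0); exact: set_valP.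
move=> /(fixed_points_gmap gf) XH; apply: contrapT => /nFH X0.
by case: XH => x; rewrite X0.
Qed.

(** A contractible discrete space is a point, which is then fixed by the group. *)
Lemma model_dim0 : @skel R G Z 1 = setT -> F setT.
Proof.
move=> dim0; have gT : is_subgroup [set: G] by apply/subgroupP.
apply/(model_fixed gT).
have [x0 [N [cN N0 N1]]] := contractibleP model_contractible.
have in1 x : @skel R G Z 1 x by rewrite dim0.
pose f (x : @skel R G Z 1) : R := if `[< set_val x = x0 >] then 1 else -1.
pose sub1 x : @skel R G Z 1 := SigSub (mem_set (in1 x)).
have csub1 : continuous sub1 by apply: continuous_set_type; exact: id_continuous.
have zx0 z : z = x0.
  have cz : continuous (fun t => f (sub1 (N (z, t)))).
    apply: (continuous_compT _ (@skel1_discrete R G Z R f)).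
    apply: (continuous_compT _ csub1); apply: (continuous_compT _ cN).
    by apply: continuous_pair; [exact: cst_continuous|exact: id_continuous].
  have := no_sign_change ler01 cz; rewrite N0 N1 //.
  have -> : f (sub1 x0) = 1 by rewrite /f asboolT.
  rewrite mulr1 /f => /(_ _)/wrap[].
    by move=> t _; case: ifP => _; rewrite ?oppr_eq0 oner_eq0.
  by case: asboolP => // _; rewrite ltr0N1.
by exists x0 => g _; exact: zx0.
Qed.

(** Edges have no inversions: an element that fixes an inner point of an edge
    fixes both ends. Hence subgroups with a fixed point fix a vertex. *)
Theorem model_tree : @skel R G Z 2 = setT ->
  exists (V : Type) (adj : V -> V -> Prop) (a : G -> V -> V),
    [/\ is_tree adj, forall v, a 1%g v = v,
        forall g h v, a (g * h)%g v = a g (a h v),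
        forall g u v, adj u v -> adj (a g u) (a g v) &
        forall H, is_subgroup H -> F H <-> exists v, forall h, H h -> a h v = v].
Proof.
move=> dim1; have [Gr _] := graph_of_complex dim1.
pose a g (v : vert Gr) : vert Gr := SigSub (mem_set (vert_act g (set_valP v))).
exists (vert Gr), (joined setT), a; split.
- exact: (contractible_graph_tree Gr model_contractible).
- by move=> v; apply/val_inj; exact: act1.
- by move=> g h v; apply/val_inj; exact: actM.
- move=> g u v [e _ uv]; exists (edge_act g e) => //.
  rewrite !chr_act -![set_val (a g _)]/(act g (set_val _)).
  by case: uv => -[-> ->]; [left|right].
move=> H gH; rewrite (model_fixed gH); split; last first.
  by case=> v vH; exists (set_val v) => h Hh; rewrite -[RHS](congr1 set_val (vH h Hh)).
case=> z zH; have [Vz|[e [t [t1 zE]]]] := graph_cover Gr z.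
  by exists (vert_of Vz) => h Hh; apply/val_inj; exact: zH.
have [V1 _] := @chr_end _ _ _ Gr e.
exists (vert_of V1) => h Hh; apply/val_inj.
rewrite -[LHS]/(act h (chr e (-1))) -chr_act; congr (chr _ _).
have := zH h Hh; rewrite -zE -chr_act => /(congr1 (@cell_of _ _ _ Gr)).
by rewrite !cell_chr // => -[].
Qed.

End Models.

(** * The telescope of a chain of subgroups *)

Section Pushouts.
Context {R : realType} {G : groupType}.

Lemma cell_boundary_continuous n (I : choiceType) (H : I -> set G) :
  continuous (@cell_boundary R G n I H).
Proof.
move=> [i [C s]] U nU.
have c : continuous (fun p : homog (H i) * @sphere R n =>
    existT _ i (p.1, set_val p.2) : disk_cells R n H).
  apply: discrete_prod_continuous => D.
  exact: (continuous_compT (@set_val_continuous _ _) (@disk_cell_continuous _ _ _ _ _ i D)).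
exact: (c (C, s) U nU).
Qed.

(** When the cells cover everything, only the existence of induced maps is at
    stake, since they are unique. *)
Lemma attaches_cells_surj (X : gspace G) n (A B : set X) (I : choiceType)
    (H : I -> set G) (q : sphere_cells R n H -> A) (Q : disk_cells R n H -> B)
    (j : A -> B) :
  (forall i, is_subgroup (H i)) ->
  (forall g i x t, set_val (Q (cell_point H i (g * x)%g t)) =
                   act g (set_val (Q (cell_point H i x t)))) ->
  (forall x, set_val (j x) = set_val x) ->
  (forall p, set_val (Q (cell_boundary p)) = set_val (q p)) ->
  continuous q -> continuous Q ->
  (forall b, exists p, Q p = b) ->
  (forall (Z : topologicalType) (u : disk_cells R n H -> Z) (v : A -> Z),
    continuous u -> continuous v -> u \o (@cell_boundary R G n I H) = v \o q ->
    exists w : B -> Z, [/\ continuous w, w \o Q = u & w \o j = v]) ->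
  attaches_cells R n A B.
Proof.
move=> gH QE jE sq cq cQ Qsurj univ; exists I, H, q, Q, j; split=> //.
have cj : continuous j.
  apply: continuous_set_type.
  have -> : set_val \o j = set_val by apply/funext => x; exact: jE.
  exact: set_val_continuous.
split; first by split=> //; exact: cell_boundary_continuous.
split; first by apply/funext => p; apply/val_inj; rewrite -[LHS]/(set_val _) sq -jE.
move=> Z u v cu cv uv; have [w [cw wQ wj]] := univ Z u v cu cv uv.
exists w; split=> // w' [_ w'Q _]; apply/funext => b.
by have [p <-] := Qsurj b; rewrite -[LHS]/((w \o Q) p) wQ -w'Q.
Qed.

Lemma attaches_no_cells (X : gspace G) n (A : set X) : attaches_cells R n A A.
Proof.
exists void, (fun _ => setT).
have no (p : disk_cells R n (fun _ : void => [set: G])) : False by case: p => -[].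
have nos (p : sphere_cells R n (fun _ : void => [set: G])) : False by case: p => -[].
exists (fun p => False_rect _ (nos p)), (fun p => False_rect _ (no p)), id.
split; [by case|by move=> g []|by []|].
split; first by split; [move=> p; case: (nos p)|move=> p; case: (nos p)|
  move=> p; case: (no p)|exact: id_continuous].
split; first by apply/funext => p; case: (nos p).
move=> Z u v cu cv uv; exists v; split.
  by split=> //; apply/funext => p; case: (no p).
by move=> w [].
Qed.

Lemma sphere0_empty (s : @sphere R 0) : False.
Proof.
have /sphere_enorm : @sphere R 0 (set_val s) by exact: set_valP.
by rewrite /enorm big_ord0 sqrtr0 => /esym/eqP; rewrite oner_eq0.
Qed.

Lemma disk0_unique (x y : @disk R 0) : x = y.
Proof. by apply/val_inj/matrixP => ? []. Qed.

End Pushouts.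

Section Telescope.
Context {R : realType} {G : groupType} (K : nat -> set G).
Hypothesis gK : forall n, is_subgroup (K n).
Hypothesis chain_succ : forall n, K n `<=` K n.+1.

Lemma chain_le m n : (m <= n)%N -> K m `<=` K n.
Proof.
move=> /subnK <-; elim: (n - m)%N => [//|k IH] g /IH; rewrite addSn.
exact: chain_succ.
Qed.

(** By induction, the map is continuous up to each integer height. *)
Lemma piecewise_continuous (Z : topologicalType) (f : R -> Z) (c : nat -> R -> Z) :
  (forall m, continuous (c m)) ->
  (forall m r, m%:R <= r <= m.+1%:R -> f r = c m r) ->
  (forall r, r <= 0 -> f r = f 0) -> continuous f.
Proof.
move=> cc fc f0.
have cmin n : continuous (fun r : R => Num.min r n%:R).
  by apply: minR_continuous; [exact: id_continuous|exact: cst_continuous].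
have cf n : continuous (fun r : R => f (Num.min r n%:R)).
  elim: n => [|n IH].
    have -> : (fun r : R => f (Num.min r 0%:R)) = fun=> f 0.
      by apply/funext => r; apply: f0; rewrite ge_min lexx orbT.
    exact: cst_continuous.
  apply: (@continuous_glue _ _ [set r : R | r <= n%:R] [set r : R | n%:R <= r]).
  - by apply: closed_leR; [exact: id_continuous|exact: cst_continuous].
  - by apply: closed_leR; [exact: cst_continuous|exact: id_continuous].
  - by move=> r /=; case: (leP r n%:R) => [|/ltW]; [left|right].
  - apply: (continuous_within_eq IH) => r /= rn.
    by rewrite !min_l // (le_trans rn) // ler_nat.
  - apply: (continuous_within_eq (continuous_compT (cmin n.+1) (cc n))) => r /= rn.
    by apply: fc; rewrite le_min rn ler_nat leqnSn ge_min lexx orbT.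
move=> r0 U fU; have r0n := truncnS_gt r0; set n := (Num.truncn r0).+1 in r0n.
have minE (r : R) : r < n%:R -> f (Num.min r n%:R) = f r by move=> rn; rewrite min_l // ltW.
have nU : \forall r \near r0, U (f (Num.min r n%:R)).
  by apply: (cf n r0); rewrite minE.
by apply: (filterS2 _ _ nU (lt_nbhsl r0n)) => r + rn; rewrite minE.
Qed.

(** The telescope has the vertices [g K_n] at height [n], joined by an edge to
    [g K_n.+1]. It is presented as a union of rays, one for each element of the
    group, where the rays through [g] and [g'] are identified from height [n] on
    when they are in the same coset of [K n]. Rays are constant at negative
    heights, which avoids a separate treatment of the half-line. *)
Definition ray_source : topologicalType := (discrete_topology G * R)%type.

Definition ray_class (x : ray_source) : R * set G :=
  (Num.max x.2 0, lcoset_of (K (Num.truncn x.2)) x.1).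

Definition same_class : rel ray_source := fun x y => `[< ray_class x = ray_class y >].

Lemma same_class_refl : reflexive same_class.
Proof. by move=> x; apply/asboolP. Qed.

Lemma same_class_sym : symmetric same_class.
Proof. by move=> x y; apply: asbool_equiv_eq; split. Qed.

Lemma same_class_trans : transitive same_class.
Proof. by move=> y x z /asboolP xy /asboolP yz; apply/asboolP; rewrite xy. Qed.

Definition class_equiv := EquivRel same_class same_class_refl same_class_sym same_class_trans.

Definition tel : topologicalType := quotient_topology {eq_quot class_equiv}%qT.

Definition ray (g : G) (r : R) : tel := (\pi_({eq_quot class_equiv}) ((g, r) : ray_source))%qT.

Lemma rayP g r g' r' : ray g r = ray g' r' <->
  ray_class (g, r) = ray_class (g', r').
Proof.
split=> [/eqmodP/asboolP//|e]; by apply/eqmodP/asboolP.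
Qed.

Lemma ray_eq g r h : 0 <= r -> K (Num.truncn r) h -> ray (g * h)%g r = ray g r.
Proof.
move=> r0 Kh; apply/esym/rayP; congr (_, _).
by apply/(lcoset_ofP (gK _)); rewrite /= mulKg.
Qed.

Lemma ray_inj g r g' r' : 0 <= r -> 0 <= r' -> ray g r = ray g' r' ->
  r = r' /\ K (Num.truncn r) (g^-1 * g')%g.
Proof.
move=> r0 r0' /rayP[]; rewrite /= !max_l // => rr'; rewrite -rr' => e; split=> //.
exact: (proj1 (lcoset_ofP (gK _) g g') e).
Qed.

Lemma ray_neg g r : r <= 0 -> ray g r = ray g 0.
Proof.
move=> r0; apply/rayP; rewrite /ray_class /= max_r // max_l // truncn0.
by have -> : Num.truncn r = 0%N by apply/truncn0Pn; rewrite -ltNge; lra.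
Qed.

Lemma ray_max g r : ray g (Num.max r 0) = ray g r.
Proof. by case: (leP r 0) => // r0; rewrite (ray_neg g r0). Qed.

Lemma ray_cover (x : tel) : exists g r, 0 <= r /\ x = ray g r.
Proof.
exists (repr x).1, (Num.max (repr x).2 0); rewrite le_max lexx orbT ray_max; split=> //.
by rewrite /ray -surjective_pairing reprK.
Qed.

Lemma ray_continuous g : continuous (ray g).
Proof.
have c : continuous (fun r : R => (g, r) : ray_source).
  by apply: continuous_pair; [exact: cst_continuous|exact: id_continuous].
exact: (continuous_compT c (@pi_continuous ray_source {eq_quot class_equiv}%qT)).
Qed.

(** The universal property of the quotient, in terms of rays. *)
Lemma tel_map (Z : topologicalType) (f : G -> R -> Z) :
  (forall g, continuous (f g)) -> (forall g r, r <= 0 -> f g r = f g 0) ->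
  (forall g r h, 0 <= r -> K (Num.truncn r) h -> f (g * h)%g r = f g r) ->
  exists w : tel -> Z, continuous w /\ forall g r, w (ray g r) = f g r.
Proof.
move=> cf fneg fK; exists (fun x => f (repr x).1 (repr x).2).
have fmax g r : f g (Num.max r 0) = f g r by case: (leP r 0) => // /fneg ->.
have fE g r g' r' : ray g r = ray g' r' -> f g r = f g' r'.
  rewrite -(ray_max g) -(ray_max g') -(fmax g) -(fmax g').
  set s := Num.max r 0; set s' := Num.max r' 0.
  have s0 : 0 <= s by rewrite /s le_max lexx orbT.
  have s0' : 0 <= s' by rewrite /s' le_max lexx orbT.
  case/(ray_inj s0 s0') => <- Kg.
  by rewrite -(fK g s _ s0 Kg) mulVKg.
have wE g r : f (repr (ray g r)).1 (repr (ray g r)).2 = f g r.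
  by apply: fE; rewrite /ray -surjective_pairing reprK.
split=> //; apply/quotient_continuous.
apply: discrete_prod_continuous => g.
have -> : (fun r : R => ((fun x : tel => f (repr x).1 (repr x).2) \o
    (\pi_({eq_quot class_equiv}))%qT) ((g, r) : ray_source)) = f g.
  by apply/funext => r; exact: wE.
exact: cf.
Qed.

Lemma tel_act_exists a : exists w : tel -> tel,
  continuous w /\ forall g r, w (ray g r) = ray (a * g)%g r.
Proof.
apply: tel_map => [g|g r r0|g r h r0 Kh]; first exact: ray_continuous.
  exact: ray_neg.
rewrite mulgA; exact: ray_eq.
Qed.

Definition tel_act a : tel -> tel := projT1 (cid (tel_act_exists a)).

Lemma tel_act_continuous a : continuous (tel_act a).
Proof. by rewrite /tel_act; case: cid => w []. Qed.

Lemma tel_act_ray a g r : tel_act a (ray g r) = ray (a * g)%g r.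
Proof. by rewrite /tel_act; case: cid => w []. Qed.

Definition tel_space : gspace G.
Proof.
apply: (@Gspace G tel tel_act) tel_act_continuous.
- by move=> x; have [g [r [_ ->]]] := ray_cover x; rewrite tel_act_ray mul1g.
- by move=> a b x; have [g [r [_ ->]]] := ray_cover x; rewrite !tel_act_ray mulgA.
Defined.

Lemma act_ray a g r : act a (ray g r : tel_space) = ray (a * g)%g r.
Proof. exact: tel_act_ray. Qed.

Definition tel_vert : set tel_space := [set x | exists g n, x = ray g n%:R].

Lemma ray_vert g r : 0 <= r -> tel_vert (ray g r) -> r = (Num.truncn r)%:R.
Proof.
move=> r0 [h [n]] /(ray_inj r0 (ler0n _ _))[-> _]; by rewrite natrK.
Qed.

Lemma tel_open (U : set tel_space) : (forall g, open (ray g @^-1` U)) -> open U.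
Proof.
move=> oU; suff : open (\pi_({eq_quot class_equiv})%qT @^-1` U : set ray_source) by [].
rewrite openE => -[g r] Ugr; exists ([set g], ray g @^-1` U) => /=.
  split; first by rewrite nbhs_principalE.
  exact: open_nbhs_nbhs.
by move=> [g' r'] [/= -> Ur]; exact: Ur.
Qed.

(** The heights of vertices are integers, and the ray is constant below [0]. *)
Lemma ray_near_vert g r0 :
  \forall r \near r0, ray g r = ray g r0 \/ ~ tel_vert (ray g r).
Proof.
have [r00|r00] := ltP r0 0.
  have : \forall r \near r0, r < 0 by exact: lt_nbhsl.
  by apply: filterS => r /ltW rn; left; rewrite (ray_neg _ rn) (ray_neg _ (ltW r00)).
have /andP[m1 m2] := truncn_itv r00; set m := Num.truncn r0 in m1 m2.
have below : \forall r \near r0, m%:R - 1 < r by apply: lt_nbhsr; lra.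
have below' : m%:R < r0 -> \forall r \near r0, m%:R < r by move=> h; exact: lt_nbhsr.
have above : \forall r \near r0, r < m.+1%:R by exact: lt_nbhsl.
have no r k : 0 <= r -> k%:R < r -> r < k.+1%:R -> ~ tel_vert (ray g r).
  move=> r0' k1 k2 /(ray_vert r0') rE; move: k1 k2; rewrite rE !ltr_nat.
  by move=> k1; rewrite ltnS leqNgt k1.
move: m1; rewrite le_eqVlt => /orP[/eqP mr|mr]; last first.
  apply: (filterS2 _ _ (below' mr) above) => r r1 r2; right.
  by apply: (no r m) => //; exact: (le_trans (ler0n R m) (ltW r1)).
apply: (filterS2 _ _ below above) => r r1 r2.
have [->|rm] := eqVneq r r0; first by left.
have [rneg|rpos] := leP r 0.
  have r00' : r0 = 0.
    apply/eqP; rewrite eq_le r00 andbT -mr; case: (m) r1 => // k r1.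
    have : 0 <= k%:R :> R by exact: ler0n.
    by move: r1; rewrite -natr1; lra.
  by left; rewrite r00' (ray_neg _ rneg).
right; have [mr'|rm'] := ltP m%:R r; first by apply: (no r m) => //; exact: ltW.
have {rm rm'}rm : r < m%:R by rewrite lt_neqAle mr rm -mr.
case: (m) rm r1 mr => [|k] rm r1 mr; first by move: rm rpos; lra.
by apply: (no r k) => //; [exact: ltW|move: r1; rewrite -natr1; lra].
Qed.

(** The complement of any set of vertices is open. *)
Lemma tel_vert_discrete (Z : topologicalType) (f : tel_vert -> Z) : continuous f.
Proof.
apply/continuousP => A _; exists (~` (set_val @` (~` (f @^-1` A)))); last first.
  apply/seteqP; split=> x /=; last by move=> Ax [y nAy /val_inj yx]; apply: nAy; rewrite yx.
  by move=> nx; apply: contrapT => nAx; apply: nx; exists x.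
apply: tel_open => g; rewrite openE => r0 Ur0.
have := ray_near_vert g r0; apply: filterS => r [rr0|nV]; first by rewrite /= rr0.
by move=> [y _ yr]; apply: nV; rewrite -yr; exact: set_valP.
Qed.

Definition tel_skel (n : nat) : set tel_space :=
  match n with 0%N => set0 | 1%N => tel_vert | _ => setT end.

Lemma tel_attach0 : attaches_cells R 0 (tel_skel 0) (tel_skel 1).
Proof.
have vP (p : disk_cells R 0 K) : tel_vert (ray (homog_repr (projT2 p).1) (projT1 p)%:R).
  by exists (homog_repr (projT2 p).1), (projT1 p).
pose Q p : tel_skel 1 := SigSub (mem_set (vP p)).
have no (x : tel_skel 0) : False by exact: (set_valP x).
pose q (p : sphere_cells R 0 K) : tel_skel 0 :=
  False_rect _ (sphere0_empty (projT2 p).2).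
pose j (x : tel_skel 0) : tel_skel 1 := False_rect _ (no x).
have QE n g t : set_val (Q (cell_point K n g t)) = ray g n%:R.
  rewrite /= -[LHS]/(ray (homog_repr (to_homog (K n) g)) n%:R).
  have [h Kh ->] := homog_repr_to (gK n) g; apply: ray_eq; first exact: ler0n.
  by rewrite natrK.
have Qsurj b : exists g n, Q (cell_point K n g (@disk0 R 0)) = b.
  have [g [n bE]] : tel_vert (set_val b) by exact: set_valP.
  by exists g, n; apply/val_inj; rewrite -[LHS]/(set_val _) QE.
apply: (@attaches_cells_surj R G tel_space 0 _ _ _ K q Q j) => //.
- by move=> a n g t; rewrite !QE act_ray.
- by move=> [i [C s]]; case: (sphere0_empty s).
- by move=> [i [C s]]; case: (sphere0_empty s).
- apply: disk_cells_continuous => n C.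
  have -> : (fun t => Q (existT _ n (C, t))) = fun=> Q (existT _ n (C, (@disk0 R 0))).
    by apply/funext => t; rewrite (disk0_unique t (@disk0 R 0)).
  exact: cst_continuous.
- by move=> b; have [g [n <-]] := Qsurj b; eexists.
move=> Z u v cu cv _.
pose w (b : tel_skel 1) : Z :=
  u (cell_point K (projT1 (cid (projT2 (cid (Qsurj b))))) (projT1 (cid (Qsurj b))) (@disk0 R 0)).
exists w; split; [exact: tel_vert_discrete| |by apply/funext => x; case: (no x)].
apply/funext => -[n [C t]]; rewrite /w /=.
case: cid => g [n' e] /=; case: cid => {e} n'' /= e.
have := congr1 set_val e; rewrite QE -[in RHS](homog_reprK C).
rewrite -[RHS]/(set_val (Q (cell_point K n (homog_repr C) t))) QE.
case/(ray_inj (ler0n _ _) (ler0n _ _)) => /eqP; rewrite eqr_nat => /eqP nn; subst n''.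
rewrite natrK => Kg; rewrite (disk0_unique t (@disk0 R 0)) -{1}(homog_reprK C).
by congr (u (existT _ n (_, _))); apply/(to_homogP (gK n)).
Qed.

Lemma tel_attach1 : attaches_cells R 1 (tel_skel 1) (tel_skel 2).
Proof.
pose hgt (i : nat) (t : R) : R := i%:R + (t + 1) / 2.
have hgt_itv i t : -1 <= t <= 1 -> i%:R <= hgt i t <= i.+1%:R.
  by rewrite /hgt -[i.+1%:R]natr1 => /andP[t1 t2]; apply/andP; split; lra.
have hgt_end i t : (t = -1 -> hgt i t = i%:R) /\ (t = 1 -> hgt i t = i.+1%:R).
  by split=> ->; rewrite /hgt -?[i.+1%:R]natr1; lra.
have hgt0 i t : -1 <= t <= 1 -> 0 <= hgt i t.
  by move=> /(hgt_itv i)/andP[+ _]; apply: le_trans; exact: ler0n.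
have hgtK i t h g : -1 <= t <= 1 -> K i h -> ray (g * h)%g (hgt i t) = ray g (hgt i t).
  move=> t1 Kh; apply: ray_eq; first exact: hgt0.
  by apply: chain_le Kh; rewrite truncn_ge_nat ?hgt0 //; case/andP: (hgt_itv i t t1).
have chgt i : continuous (fun x : @disk R 1 => hgt i (interval_coord x)).
  apply: addR_continuous; first exact: cst_continuous.
  apply: mulR_continuous; last exact: cst_continuous.
  by apply: addR_continuous; [exact: interval_coord_continuous|exact: cst_continuous].
pose pt n (C : homog (K n)) x := ray (homog_repr C) (hgt n (interval_coord x)).
pose Q (p : disk_cells R 1 K) : tel_skel 2 :=
  SigSub (mem_set (I : [set: tel_space] (pt (projT1 p) (projT2 p).1 (projT2 p).2))).
have vP (p : sphere_cells R 1 K) : tel_vert (pt (projT1 p) (projT2 p).1 (set_val (projT2 p).2)).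
  case: p => n [C s]; rewrite /pt /=; have [e1 e2] := hgt_end n (interval_coord (set_val s)).
  by case: (sphere1_coord s) => [/e1|/e2] ->; eexists; eexists.
pose q (p : sphere_cells R 1 K) : tel_skel 1 := SigSub (mem_set (vP p)).
pose j (x : tel_skel 1) : tel_skel 2 := SigSub (mem_set (I : [set: tel_space] (set_val x))).
have QE n g x : set_val (Q (cell_point K n g x)) = ray g (hgt n (interval_coord x)).
  rewrite -[LHS]/(pt n (to_homog (K n) g) x) /pt.
  by have [h Kh ->] := homog_repr_to (gK n) g; apply: hgtK => //; exact: interval_coord_itv.
have n11 : -1 <= (-1 : R) <= 1 by lra.
have p11 : -1 <= (1 : R) <= 1 by lra.
have cell0 g n : set_val (Q (cell_point K n g (interval_point (-1)))) = ray g n%:R.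
  by rewrite QE interval_pointK // (proj1 (hgt_end n (-1))).
have cell1 g n : set_val (Q (cell_point K n g (interval_point 1))) = ray g n.+1%:R.
  by rewrite QE interval_pointK // (proj2 (hgt_end n 1)).
have hgt_inv n t : t = 2 * (hgt n t - n%:R) - 1 by rewrite /hgt; lra.
have cpt : continuous (fun p : disk_cells R 1 K => pt (projT1 p) (projT2 p).1 (projT2 p).2).
  apply: disk_cells_continuous => n C.
  exact: (continuous_compT (chgt n) (@ray_continuous (homog_repr C))).
apply: (@attaches_cells_surj R G tel_space 1 _ _ _ K q Q j) => //.
- by move=> a n g t; rewrite !QE act_ray.
- apply: continuous_set_type.
  exact: (continuous_compT (@cell_boundary_continuous R G 1 _ K) cpt).
- exact: continuous_set_type.
- move=> b; have [g [r [r0 bE]]] := ray_cover (set_val b).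
  have /andP[n1 n2] := truncn_itv r0; set n := Num.truncn r in n1 n2.
  exists (cell_point K n g (interval_point (2 * (r - n%:R) - 1))).
  apply/val_inj; rewrite -[LHS]/(set_val _) QE interval_pointK; last first.
    by move: n2; rewrite -[n.+1%:R]natr1 => n2; apply/andP; split; lra.
  rewrite -[RHS]/(set_val b) bE; congr ray.
  by rewrite /hgt; lra.
move=> Z u v cu cv uv.
have u_vert n g t y : `|t| = 1 -> set_val y = set_val (Q (cell_point K n g (interval_point t))) ->
    u (cell_point K n g (interval_point t)) = v y.
  move=> t1 yE; have /= := congr1 (fun F => F (existT _ n (to_homog (K n) g, interval_end t1))) uv.
  rewrite -[X in X = _]/(u (cell_point K n g (interval_point t))) => ->.
  by congr v; apply/val_inj; rewrite -[RHS]/(set_val y) yE.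
pose c g n (r : R) : Z := u (cell_point K n g (interval_point (2 * (r - n%:R) - 1))).
have cc g n : continuous (c g n).
  have cr : continuous (fun r : R => 2 * (r - n%:R) - 1).
    apply: addR_continuous; last exact: cst_continuous.
    apply: mulR_continuous; first exact: cst_continuous.
    by apply: addR_continuous; [exact: id_continuous|exact: cst_continuous].
  have ci := continuous_compT cr interval_point_continuous.
  have cd := continuous_compT ci (@disk_cell_continuous R G 1 _ K n (to_homog (K n) g)).
  exact: (continuous_compT cd cu).
pose f g r := c g (Num.truncn r) (Num.max r 0).
have c_vert g n y : set_val y = ray g n%:R -> c g n n%:R = v y.
  move=> yE; rewrite /c subrr mulr0 sub0r; apply: u_vert; first exact: normrN1.
  by rewrite yE cell0.
have c_vert' g n y : set_val y = ray g n.+1%:R -> c g n n.+1%:R = v y.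
  move=> yE; rewrite /c -[n.+1%:R]natr1.
  have -> : 2 * (n%:R + 1 - n%:R) - 1 = 1 :> R by lra.
  by apply: u_vert; [exact: normr1|rewrite yE cell1].
have f_c g n r : n%:R <= r <= n.+1%:R -> f g r = c g n r.
  move=> /andP[r1 r2]; have r0 : 0 <= r by apply: le_trans r1; exact: ler0n.
  rewrite /f max_l //; move: r2; rewrite le_eqVlt => /orP[/eqP ->|r2]; last first.
    by rewrite (@truncn_def _ r n) // r1.
  rewrite natrK; have yV : tel_vert (ray g n.+1%:R) by exists g, n.+1.
  pose y : tel_skel 1 := SigSub (mem_set yV).
  by rewrite (c_vert _ _ y) // (c_vert' _ _ y).
have f_neg g r : r <= 0 -> f g r = f g 0.
  move=> r0; rewrite /f max_r // max_l // truncn0.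
  by have -> : Num.truncn r = 0%N by apply/truncn0Pn; rewrite -ltNge; lra.
have f_K g r h : 0 <= r -> K (Num.truncn r) h -> f (g * h)%g r = f g r.
  move=> r0 Kh; rewrite /f /c /cell_point; congr (u (existT _ _ (_, _))).
  by apply/(to_homogP (gK _)); rewrite invgM mulgVK; exact: subgroupV.
have [w [cw wE]] := tel_map (fun g => piecewise_continuous (cc g) (f_c g) (f_neg g)) f_neg f_K.
exists (w \o set_val); split.
- exact: (continuous_compT (@set_val_continuous _ _) cw).
- apply/funext => -[n [C x]]; rewrite /= -[LHS]/(w (pt n C x)) /pt wE.
  rewrite (f_c _ n) ?hgt_itv ?interval_coord_itv // /c -hgt_inv interval_coordK.
  by rewrite /cell_point homog_reprK.
- apply/funext => y; rewrite /= -[LHS]/(w (set_val y)).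
  have [g [n yE]] : tel_vert (set_val y) by exact: set_valP.
  rewrite yE wE (f_c g n) ?lexx ?ler_nat ?leqnSn //; exact: c_vert.
Qed.

Lemma tel_skel_act n g x : tel_skel n x -> tel_skel n (act g x).
Proof.
case: n => [|[|n]] //= [h [k ->]].
by exists (g * h)%g, k; exact: act_ray.
Qed.

Lemma tel_skelS n : attaches_cells R n (tel_skel n) (tel_skel n.+1).
Proof.
case: n => [|[|n]]; [exact: tel_attach0|exact: tel_attach1|].
exact: attaches_no_cells.
Qed.

Lemma tel_skel_cover : \bigcup_n tel_skel n = setT.
Proof. by apply/seteqP; split=> // x _; exists 2%N. Qed.

Lemma tel_skel_colim (U : set tel_space) :
  (forall n, open (set_val @^-1` U : set (tel_skel n))) -> open U.
Proof.
move=> /(_ 2%N) oU; pose sub2 x : tel_skel 2 := SigSub (mem_set (I : [set: tel_space] x)).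
have csub2 : continuous sub2 by apply: continuous_set_type; exact: id_continuous.
by move/continuousP: csub2 => /(_ _ oU).
Qed.

Definition tel_gcw : gcw R G :=
  @Gcw R G tel_space tel_skel tel_skel_act erefl tel_skelS tel_skel_cover tel_skel_colim.

Lemma ray_up g g' r s : 0 <= r -> r <= s -> ray g r = ray g' r -> ray g s = ray g' s.
Proof.
move=> r0 rs /(ray_inj r0 r0)[_ Kg].
rewrite -(mulVKg g g'); apply/esym; apply: ray_eq; first exact: le_trans rs.
by apply: chain_le Kg; exact: le_truncn.
Qed.

Hypothesis chain_cover : forall g, exists n, K n g.

Lemma entry_subproof g : exists n, `[< K n g >].
Proof. by have [n Kg] := chain_cover g; exists n; apply/asboolP. Qed.

(** The height at which the ray through [g] meets the ray through the identity. *)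
Definition entry g : nat := ex_minn (entry_subproof g).

Lemma entryP g n : K n g <-> (entry g <= n)%N.
Proof.
rewrite /entry; case: ex_minnP => m /asboolP Km min; split.
  by move=> Kn; apply: min; apply/asboolP.
by move=> mn; apply: chain_le mn _ Km.
Qed.

(** The telescope is a tree, and this is its geodesic contraction up to the
    parametrization. Each point flows up along its ray until it meets the ray through the
    identity at a height at least [N], and then down this ray to height [N]. *)
Section Contraction.
Variable N : nat.

Let meet g (s : R) : R := Num.max (Num.max s 0) (Num.max N%:R (entry g)%:R).

Let flow g (p : R * R) : tel :=
  if p.2 <= 1 / 2
  then ray g (Num.max p.1 0 + 2 * clamp p.2 * (meet g p.1 - Num.max p.1 0))
  else ray 1%g (meet g p.1 + (2 * clamp p.2 - 1) * (N%:R - meet g p.1)).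

Let meet_ray g s : ray g (meet g s) = ray 1%g (meet g s).
Proof.
have m0 : 0 <= meet g s by rewrite /meet !le_max lexx orbT.
rewrite -[X in ray X _ = _]mul1g; apply: ray_eq => //; apply/entryP.
by rewrite truncn_ge_nat // /meet !le_max lexx !orbT.
Qed.

Let meet_mul g s h : 0 <= s -> K (Num.truncn s) h -> meet (g * h)%g s = meet g s.
Proof.
have le x y : 0 <= s -> K (Num.truncn s) y -> meet (x * y)%g s <= meet x s.
  move=> s0 Ky; rewrite /meet (max_l s0) !ge_max !le_max !lexx orbT /=.
  have [xs|xs] := leqP (entry x) (Num.truncn s).
    have : K (Num.truncn s) (x * y)%g by apply: (subgroupM (gK _)) => //; apply/entryP.
    by move/entryP; rewrite truncn_ge_nat // => ->.
  have : K (entry x) (x * y)%g.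
    by apply: (subgroupM (gK _)); [exact/entryP|exact: chain_le (ltnW xs) _ Ky].
  by move/entryP; rewrite -(ler_nat R) => ->; rewrite !orbT.
move=> s0 Kh; apply/eqP; rewrite eq_le le //=.
by rewrite -{1}(mulgK h g); apply: le => //; exact: (subgroupV (gK _)).
Qed.

Let flow_continuous g : continuous (flow g).
Proof.
have cs : continuous (fun p : R * R => Num.max p.1 0).
  by apply: maxR_continuous; [exact: fst_continuous|exact: cst_continuous].
have cm : continuous (fun p : R * R => meet g p.1).
  by apply: maxR_continuous => //; exact: cst_continuous.
have ct : continuous (fun p : R * R => 2 * clamp p.2).
  apply: mulR_continuous; first exact: cst_continuous.
  exact: (continuous_compT snd_continuous clamp_continuous).
apply: (@continuous_glue _ _ [set p : R * R | p.2 <= 1 / 2] [set p : R * R | 1 / 2 <= p.2]).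
- by apply: closed_leR; [exact: snd_continuous|exact: cst_continuous].
- by apply: closed_leR; [exact: cst_continuous|exact: snd_continuous].
- by move=> p; case: (leP p.2 (1 / 2)) => [|/ltW]; [left|right].
- have c : continuous (fun p : R * R =>
      Num.max p.1 0 + 2 * clamp p.2 * (meet g p.1 - Num.max p.1 0)).
    apply: addR_continuous => //; apply: mulR_continuous => //.
    by apply: addR_continuous => //; exact: oppR_continuous.
  apply: (continuous_within_eq (continuous_compT c (@ray_continuous g))) => p /= p2.
  by rewrite /flow p2.
- have c : continuous (fun p : R * R =>
      meet g p.1 + (2 * clamp p.2 - 1) * (N%:R - meet g p.1)).
    apply: addR_continuous => //; apply: mulR_continuous.
      by apply: addR_continuous => //; exact: cst_continuous.
    by apply: addR_continuous; [exact: cst_continuous|exact: oppR_continuous].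
  apply: (continuous_within_eq (continuous_compT c (@ray_continuous 1%g))) => p /= p2.
  rewrite /flow; case: ifP => // p2'.
  have -> : p.2 = 1 / 2 by apply/eqP; rewrite eq_le p2 p2'.
  have h1 : 0 <= (1 / 2 : R) <= 1 by lra.
  rewrite (clamp_id h1).
  have -> : 2 * (1 / 2) = 1 :> R by lra.
  by rewrite mul1r subrr mul0r addr0 addrC subrK meet_ray.
Qed.

Let flow_height g s t : Num.max s 0 <=
  Num.max s 0 + 2 * clamp t * (meet g s - Num.max s 0).
Proof.
rewrite lerDl; apply: mulr_ge0; last by rewrite subr_ge0 /meet le_max lexx.
by apply: mulr_ge0 => //; case/andP: (clamp_itv t).
Qed.

Lemma tel_contraction : exists h : tel_space * R -> tel_space, [/\ continuous h,
  forall x, h (x, 0) = x, forall x, h (x, 1) = ray 1%g N%:R &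
  forall A x t, A `<=` K N -> fixed_points tel_space A x ->
    fixed_points tel_space A (h (x, t))].
Proof.
pose path g s : @compact_open R tel := curry (flow g) s.
have cpath g : continuous (path g).
  exact: (proj1 (continuous_curry (@flow_continuous g))).
have path_neg g s : s <= 0 -> path g s = path g 0.
  move=> s0; apply/funext => t; rewrite /path /curry /flow /= /meet.
  by rewrite (max_r s0) (max_l (lexx 0)).
have path_K g s h : 0 <= s -> K (Num.truncn s) h -> path (g * h)%g s = path g s.
  move=> s0 Kh; apply/funext => t; rewrite /path /curry /flow /= (meet_mul _ s0 Kh).
  case: ifP => // t2; apply: ray_eq.
    by apply: le_trans (flow_height g s t); rewrite le_max lexx orbT.
  by apply: chain_le Kh; apply: le_truncn; rewrite -{1}(max_l s0).
have [w [cw wE]] := tel_map cpath path_neg path_K.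
have cwx x : continuous (w x : R -> tel).
  have [g [r [_ ->]]] := ray_cover x; rewrite wE.
  exact: (proj2 (continuous_curry (@flow_continuous g)) r).
exists (fun p => (w p.1 : R -> tel) p.2); split.
- have -> : (fun p : tel_space * R => (w p.1 : R -> tel) p.2) =
      uncurry (fun x => (w x : R -> tel)) by apply/funext => -[].
  apply: (@continuous_uncurry tel R tel (fun x => (w x : R -> tel))) => //.
  exact: locally_compactR.
- move=> x /=; have [g [r [r0 ->]]] := ray_cover x; rewrite wE /path /curry /flow /=.
  by rewrite divr_ge0 // clamp0 mulr0 mul0r addr0 ray_max.
- move=> x /=; have [g [r [r0 ->]]] := ray_cover x; rewrite wE /path /curry /flow /=.
  rewrite ifF; last by apply/negbTE; rewrite -ltNge; lra.
  by congr ray; rewrite clamp1; lra.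
move=> A x t AK Ax a Aa /=; have [g [r [r0 xE]]] := ray_cover x.
have := Ax a Aa; rewrite xE wE act_ray /path /curry /flow /= => agr.
case: ifP => t2.
  rewrite tel_act_ray; apply: (ray_up _ _ agr) => //.
  by rewrite -{1}(max_l r0); exact: flow_height.
rewrite tel_act_ray mulg1 -[a in LHS]mul1g; set y := (X in ray _ X).
have Ny : N%:R <= y.
  have c1 : 1 / 2 <= clamp t.
    by rewrite /clamp le_max le_min; apply/orP; right; apply/andP; split; [lra|lra].
  have /andP[_ c2] := clamp_itv t.
  have mN : N%:R <= meet g r by rewrite /meet !le_max lexx orbT.
  have -> : y = N%:R + (2 - 2 * clamp t) * (meet g r - N%:R) by rewrite /y; ring.
  by rewrite lerDl mulr_ge0 // subr_ge0 //; lra.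
have y0 : 0 <= y by apply: le_trans Ny; exact: ler0n.
by apply: ray_eq => //; apply: chain_le (AK a Aa); rewrite truncn_ge_nat.
Qed.

End Contraction.

(** A finite subgroup lies in some [K N], so it fixes the vertex at height [N] on
    the ray through the identity and every point of the paths of the contraction
    to this vertex that start at a fixed point. Conversely stabilizers are
    conjugate to subgroups of some [K n]. *)
Lemma tel_classifying : (forall n, finite_set (K n)) ->
  classifying_space (fin_subgroups G) tel_gcw.
Proof.
move=> K_fin H gH; split; last first.
  move=> nF; apply/eqP; apply/negPn/negP => /set0P[x Hx]; apply: nF; split=> //.
  have [g [r [r0 xE]]] := ray_cover x.
  apply: (sub_finite_set _ (finite_image (fun k => g * k * g^-1)%g (K_fin (Num.truncn r)))).
  move=> h Hh; exists (g^-1 * h * g)%g; last by rewrite !mulgA mulgV mul1g mulgK.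
  have := Hx h Hh; rewrite xE act_ray => /esym/(ray_inj r0 r0)[_].
  by rewrite mulgA.
move=> [_ finH].
have [N HN] : exists N, H `<=` K N.
  have [s HE] := (finite_seqP _).1 finH.
  suff : exists N, [set` s] `<=` K N by rewrite HE.
  elim: s {HE} => [|h s [N sN]]; first by exists 0%N.
  exists (maxn N (entry h)) => g; rewrite /= in_cons => /orP[/eqP->|gs].
    by apply/entryP; rewrite leq_maxr.
  by apply: chain_le (sN g gs); rewrite leq_maxl.
have [h [ch h0 h1 hH]] := tel_contraction N.
have x0H : fixed_points tel_space H (ray 1%g N%:R).
  move=> a Ha; rewrite act_ray mulg1 -[a]mul1g; apply: ray_eq; first exact: ler0n.
  by rewrite natrK; exact: HN.
pose h' (p : fixed_points tel_space H * R) : fixed_points tel_space H :=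
  SigSub (mem_set (hH H (set_val p.1) p.2 HN (set_valP p.1))).
exists (SigSub (mem_set x0H)), h'; split.
- apply: continuous_subspaceT; apply: continuous_set_type.
  apply: (continuous_compT _ ch); apply: continuous_pair; last exact: snd_continuous.
  exact: (continuous_compT fst_continuous (@set_val_continuous _ _)).
- by move=> x; apply/val_inj; exact: h0.
- by move=> x; apply/val_inj; exact: h1.
Qed.

End Telescope.

(** * Virtually cyclic subgroups *)

Section VirtuallyCyclic.
Context {G : groupType}.
Implicit Types (H : set G) (c g x : G).

Lemma nat_collision {T} (f : nat -> T) (A : set T) : finite_set A ->
  (forall n, A (f n)) -> exists m n, (m < n)%N /\ f m = f n.
Proof.
move=> finA fA; apply: contrapT => noc; apply: infinite_nat.
apply: (@finite_set_inj _ _ f); last first.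
  by apply: sub_finite_set finA => _ [n _ <-]; exact: fA.
move=> m n _ _ mn; case: (ltngtP m n) => // lt; case: noc.
  by exists m, n.
by exists n, m.
Qed.

Lemma expg_collision x m n : (m < n)%N -> (x ^+ m)%g = (x ^+ n)%g ->
  exists2 k, (0 < k)%N & (x ^+ k)%g = 1%g.
Proof.
move=> mn e; exists (n - m)%N; first by rewrite subn_gt0.
by rewrite expgnFr 1?ltnW // -e mulgV.
Qed.

Lemma finite_order_gen c k : (0 < k)%N -> (c ^+ k)%g = 1%g -> finite_set (gen [set c]).
Proof.
move=> k0 ck; have mod n : (c ^+ n)%g = (c ^+ (n %% k))%g.
  by rewrite [in LHS](divn_eq n k) expgnDr mulnC expgnA ck expg1n mul1g.
apply: sub_finite_set (finite_image (fun n => c ^+ n)%g (finite_II k)).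
have pow n : ((fun n => c ^+ n)%g @` `I_k) (c ^+ n)%g.
  by exists (n %% k)%N; [rewrite /= ltn_mod|rewrite -mod].
move=> x /gen1P[n [->|->]] //.
have -> : (c ^- n = c ^+ (k * n - n))%g => //.
by rewrite expgnFr ?leq_pmull // expgnA ck expg1n mul1g.
Qed.

Lemma infinite_order c n : infinite_set (gen [set c]) -> (0 < n)%N -> (c ^+ n)%g <> 1%g.
Proof. by move=> inf n0 cn; apply: inf; exact: finite_order_gen cn. Qed.

Lemma finite_of_finite_index H c : finite_set (gen [set c]) ->
  finite_set [set lcoset_of (gen [set c]) x | x in H] -> finite_set H.
Proof.
move=> finc finH; pose A := [set lcoset_of (gen [set c]) x | x in H].
apply: (@sub_finite_set _ _ (\bigcup_(D in A) D)).
  move=> x Hx; exists (lcoset_of (gen [set c]) x); first by exists x.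
  by exists 1%g; [exact: (subgroup1 (gen_subgroup _))|rewrite mulg1].
by apply: bigcup_finite => // _ [x _ <-]; exact: finite_image.
Qed.

Lemma fin_vcyc : fin_subgroups G `<=` vcyc_subgroups G.
Proof.
move=> H [gH finH]; split=> //; exists 1%g; first exact: subgroup1.
exact: finite_image.
Qed.

Lemma cyclic_vcyc c : vcyc_subgroups G (gen [set c]).
Proof.
split; first exact: gen_subgroup.
exists c; first exact: mem_gen1.
apply: sub_finite_set (finite_set1 (lcoset_of (gen [set c]) 1%g)).
move=> _ [x cx <-] /=; apply/(lcoset_ofP (gen_subgroup _)).
by rewrite mulg1; exact: (subgroupV (gen_subgroup _)).
Qed.

Lemma fin_set1 : fin_subgroups G [set 1%g].
Proof. by split; [exact: subgroup_set1|exact: finite_set1]. Qed.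

(** The powers of [x] meet finitely many cosets. *)
Lemma vcyc_power H d x : is_subgroup H ->
  finite_set [set lcoset_of (gen [set d]) y | y in H] -> H x ->
  exists n e, [/\ (0 < n)%N & (x ^+ n)%g = (d ^+ e)%g \/ (x ^+ n)%g = (d ^- e)%g].
Proof.
move=> gH finH Hx.
have [n|i [j [ij]]] := nat_collision (f := fun n => lcoset_of (gen [set d]) (x ^+ n)%g) finH.
  by exists (x ^+ n)%g => //; exact: subgroupX.
move/(lcoset_ofP (gen_subgroup _)).
have -> : (x ^- i * x ^+ j = x ^+ (j - i))%g.
  by rewrite -{1}(subnKC (ltnW ij)) expgnDr mulKg.
by case/gen1P => e xe; exists (j - i)%N, e; rewrite subn_gt0.
Qed.

(** Two elements of infinite order have powers in the same cyclic subgroup of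
    finite index, hence common powers up to inversion. *)
Lemma vcyc_commensurable H c y : vcyc_subgroups G H -> H c -> H y ->
  (forall n, (0 < n)%N -> (c ^+ n)%g <> 1%g) ->
  (forall n, (0 < n)%N -> (y ^+ n)%g <> 1%g) ->
  exists m n, [/\ (0 < m)%N, (0 < n)%N &
    (y ^+ n)%g = (c ^+ m)%g \/ (y ^+ n)%g = (c ^- m)%g].
Proof.
move=> [gH [d _ finH]] Hc Hy c_inf y_inf.
have [p [e [p0 cp]]] := vcyc_power gH finH Hc.
have [q [f [q0 yq]]] := vcyc_power gH finH Hy.
have e0 : (0 < e)%N.
  by case: e cp => // cp; case: (c_inf p p0); case: cp => ->; rewrite expg0 ?invg1.
have f0 : (0 < f)%N.
  by case: f yq => // yq; case: (y_inf q q0); case: yq => ->; rewrite expg0 ?invg1.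
exists (p * f)%N, (q * e)%N; rewrite !muln_gt0 p0 f0 q0 e0; split=> //.
rewrite !expgnA; case: cp => ->; case: yq => ->; rewrite ?expVgn -?expgnA ?invgK.
- by left; rewrite mulnC.
- by right; rewrite mulnC.
- by right; rewrite mulnC.
- by left; rewrite mulnC.
Qed.

End VirtuallyCyclic.

(** * The point *)

Section Point.
Context {R : realType} {G : groupType}.

Definition point_space : gspace G :=
  @Gspace G (discrete_topology unit) (fun _ x => x) (fun=> erefl) (fun _ _ _ => erefl)
    (fun _ => @id_continuous _).

Definition point_skel (n : nat) : set point_space := if n is 0%N then set0 else setT.

Lemma point_attach0 : attaches_cells R 0 (point_skel 0) (point_skel 1).
Proof.
pose H (_ : unit) : set G := setT.
have no (x : point_skel 0) : False by exact: (set_valP x).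
pose q (p : sphere_cells R 0 H) : point_skel 0 :=
  False_rect _ (sphere0_empty (projT2 p).2).
pose b : point_skel 1 := SigSub (mem_set (I : [set: point_space] tt)).
pose j (x : point_skel 0) : point_skel 1 := False_rect _ (no x).
pose p0 : disk_cells R 0 H := cell_point H tt 1%g (@disk0 R 0).
apply: (@attaches_cells_surj R G point_space 0 _ _ _ H q (fun=> b) j).
- by move=> i; apply/subgroupP.
- by [].
- by move=> x; case: (no x).
- by move=> p; case: (sphere0_empty (projT2 p).2).
- by move=> p; case: (sphere0_empty (projT2 p).2).
- exact: cst_continuous.
- by move=> x; exists p0; apply/val_inj; case: (val x).
move=> Z u v _ _ _; exists (fun=> u p0); split.
- exact: cst_continuous.
- apply/funext => -[[] [C t]] /=; congr (u (existT _ tt (_, _))).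
    by rewrite -(homog_reprK C); apply/(to_homogP (H := H tt)); [apply/subgroupP|].
  exact: disk0_unique.
- by apply/funext => x; case: (no x).
Qed.

Lemma point_skelS n : attaches_cells R n (point_skel n) (point_skel n.+1).
Proof. case: n => [|n]; [exact: point_attach0|exact: attaches_no_cells]. Qed.

Lemma point_skel_cover : \bigcup_n point_skel n = setT.
Proof. by apply/seteqP; split=> // x _; exists 1%N. Qed.

Lemma point_open (U : set point_space) : open U.
Proof. exact: (@discrete_open (discrete_topology unit)). Qed.

Definition point_gcw : gcw R G.
Proof.
apply: (@Gcw R G point_space point_skel) erefl point_skelS point_skel_cover _.
- by case.
- by move=> U _; exact: point_open.
Defined.

(** If the family contains the whole group, the classifying space contracts
    equivariantly to a fixed point. *)
Lemma hdim_point (F : set (set G)) (X : gcw R G) : classifying_space F X ->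
  F setT -> (hdim R X <= 0%:R%:E)%E.
Proof.
move=> FX FT; apply: (@hdim_le R G point_gcw) => //.
have gT : is_subgroup [set: G] by apply/subgroupP.
have [x0 _] := proj1 (FX _ gT) FT.
pose f (_ : point_gcw) : X := set_val x0; pose k (_ : X) : point_gcw := tt.
have gf : gmap f.
  by split=> [|g x]; [exact: cst_continuous|rewrite (set_valP x0)].
have gk : gmap k by split=> // x; exact: cst_continuous.
exists f, k; split=> //.
  exists (fun p => p.1) => //; split; [|by case|by case].
  by apply: continuous_subspaceT; exact: fst_continuous.
apply: gmap_homotopic => [H gH [x xH]||].
- apply: (proj1 (FX H gH)); apply: contrapT => /(proj2 (FX H gH)) X0.
  by move: xH; rewrite X0.
- by split=> [|g x]; [exact: cst_continuous|rewrite /= -(proj2 gf)].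
- by split=> //; exact: id_continuous.
Qed.

End Point.

(** * The characterization *)

Theorem mainTheorem11 (R : realType) (G : groupType)
  (G_countable : countable [set: G])
  (EG EEG : gcw R G)
  (EG_model : classifying_space (fin_subgroups G) EG)
  (EEG_model : classifying_space (vcyc_subgroups G) EEG) :
  (infinite_set [set: G] /\ locally_finite G) <->
  (hdim R EG = 1%:E /\ hdim R EEG = 1%:E).
Proof.
have gT : is_subgroup [set: G] by apply/subgroupP.
split=> [[G_inf G_lf]|[dimEG dimEEG]].
  have vcyc_fin : vcyc_subgroups G = fin_subgroups G.
    apply/seteqP; split; last exact: fin_vcyc.
    move=> H [gH [c Hc finH]]; split=> //; apply: finite_of_finite_index finH.
    by apply: G_lf; exact: finite_set1.
  suff dim1 (X : gcw R G) : classifying_space (fin_subgroups G) X -> hdim R X = 1%:E.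
    by split; apply: dim1 => //; rewrite -vcyc_fin.
  move=> FX; have /countable_injP[num num_inj] := G_countable.
  (* The chain of subgroups generated by the first elements of an enumeration. *)
  pose S n := [set g : G | (num g < n)%N]; pose K n := gen (S n).
  have S_fin n : finite_set (S n).
    apply: (@finite_set_inj _ _ num).
      by move=> x y _ _; apply: num_inj; rewrite in_setT.
    by apply: sub_finite_set (finite_II n) => _ [g gn <-].
  have gK n : is_subgroup (K n) by exact: gen_subgroup.
  have chain_succ n : K n `<=` K n.+1 by apply: gen_subset => g /= gn; exact: ltnW.
  have chain_cover g : exists n, K n g by exists (num g).+1; apply: sub_gen; exact: ltnSn.
  have tel_model := tel_classifying (R := R) gK chain_succ chain_cover (fun n => G_lf _ (S_fin n)).
  apply/eqP; rewrite eq_le; apply/andP; split.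
    apply: (hdim_le (n := 1) (classifying_space_unique tel_model FX)).
    by [].
  rewrite leNgt; apply/negP => dim0.
  have [Z [ZX Z0]] := hdim_lt (n := 0) dim0.
  have [_ finG] := model_dim0 fin_set1 FX ZX Z0.
  exact: G_inf.
have G_inf : infinite_set [set: G].
  move=> finG; have := hdim_point EG_model (conj gT finG).
  by rewrite dimEG lee_fin ler10.
split=> // S finS.
have tree F (X : gcw R G) : F [set 1%g] -> classifying_space F X -> hdim R X = 1%:E ->
    exists (V : Type) (adj : V -> V -> Prop) (a : G -> V -> V),
    [/\ is_tree adj, forall v, a 1%g v = v,
        forall g h v, a (g * h)%g v = a g (a h v),
        forall g u v, adj u v -> adj (a g u) (a g v) &
        forall H, is_subgroup H -> F H <-> exists v, forall h, H h -> a h v = v].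
  move=> F1 FX dimX; have [|Z [ZX Z1]] := hdim_lt (R := R) (X := X) (n := 1).
    by rewrite dimX lte_fin ltr1n.
  exact: (model_tree F1 FX ZX Z1).
have [V1 [adj1 [a1 [T1 a1_1 a1_M a1_adj a1_fix]]]] := tree _ _ fin_set1 EG_model dimEG.
have [V2 [adj2 [a2 [T2 a2_1 a2_M a2_adj a2_fix]]]] :=
  tree _ _ (fin_vcyc fin_set1) EEG_model dimEEG.
have [v2 _] := (a2_fix _ subgroup_set1).1 (fin_vcyc fin_set1).
have [v1 _] := (a1_fix _ subgroup_set1).1 fin_set1.
(* Each element fixes a vertex of the second tree, as cyclic groups are virtually
   cyclic; so does each finitely generated subgroup. *)
have fg_vcyc (A : set G) : finite_set A -> vcyc_subgroups G (gen A).
  move=> finA; apply/(a2_fix _ (gen_subgroup A)).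
  apply: (fixed_vertex_of_elliptic T2 a2_1 a2_M a2_adj v2 finA) => g _.
  have [v vP] := (a2_fix _ (gen_subgroup [set g])).1 (cyclic_vcyc g).
  by exists v; apply: vP; exact: mem_gen1.
apply: contrapT => S_inf.
have [_ [c Sc fin_index]] := fg_vcyc S finS.
have c_inf : infinite_set (gen [set c]).
  by move=> finc; apply: S_inf; exact: finite_of_finite_index finc fin_index.
have stab v : finite_set [set g | a1 g v = v].
  have gv := stabilizer_subgroup a1_1 a1_M v.
  by have [_] : fin_subgroups G [set g | a1 g v = v] by apply/(a1_fix _ gv); exists v.
(* On the first tree no power of [c] fixes a vertex, stabilizers being finite. *)
have c_free n v : (0 < n)%N -> a1 (c ^+ n)%g v <> v.
  move=> n0 cv; have gv := stabilizer_subgroup a1_1 a1_M v.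
  have [m|i [j [ij]]] := nat_collision (f := fun m => (c ^+ n ^+ m)%g) (stab v).
    by apply: (subgroupX gv).
  case/(expg_collision ij) => k k0; rewrite -expgnA => ck.
  by apply: (infinite_order c_inf _ ck); rewrite muln_gt0 n0.
have comm g : exists m n, [/\ (0 < m)%N, (0 < n)%N &
    (c ^+ n * g)%g = (g * c ^+ m)%g \/ (c ^+ n * g)%g = (g * c ^- m)%g].
  have powJ n : (c ^+ n * g)%g = (g * (g^-1 * c * g) ^+ n)%g.
    elim: n => [|n IH]; first by rewrite !expg0 mul1g mulg1.
    by rewrite !expgSr [RHS]mulgA -IH !mulgA mulgK.
  have pow_inf n : (0 < n)%N -> ((g^-1 * c * g) ^+ n)%g <> 1%g.
    move=> n0 yn; apply: (infinite_order c_inf n0).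
    by have := powJ n; rewrite yn mulg1 => /(congr1 (fun x => x * g^-1)%g); rewrite mulgK mulgV.
  have gcg := gen_subgroup [set c; g].
  have Kc : gen [set c; g] c by apply: sub_gen; left.
  have Kg : gen [set c; g] g by apply: sub_gen; right.
  have Ky : gen [set c; g] (g^-1 * c * g)%g.
    by apply: (subgroupM gcg) => //; apply: (subgroupM gcg) => //; exact: (subgroupV gcg).
  have [m [n [m0 n0 yn]]] := vcyc_commensurable (fg_vcyc _ (finite_set2 c g)) Kc Ky
    (fun n => infinite_order c_inf) pow_inf.
  by exists m, n; split=> //; rewrite powJ; case: yn => ->; [left|right].
have fin_G := finite_index_of_commensurated T1 a1_1 a1_M a1_adj c_free v1 stab comm.
have : vcyc_subgroups G [set: G] by split=> //; exists c.
by move/(hdim_point EEG_model); rewrite dimEEG lee_fin ler10.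
Qed.
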